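(* Let $r\ge1$ be an arbitrary natural number and let $B_k^*$ ($k\ge 1$) be the Bernoulli numbers, satisfying for every natural number $s\ge1$ the recurrence $$\sum_{k=0}^{s-1}(-1)^k\binom{2s+1}{2k+1}B_{k+1}^*=\frac12 .$$ Then the Riemann zeta function satisfies $$\begin{aligned}\zeta(2r+1)=\ &\frac{2^{4r+1}}{2^{4r+1}+2^{2r}-1}\sum_{k=1}^{r-1}(-1)^{k-1}\frac{1}{(2k)!}\left(\frac{\pi}{2}\right)^{2k}\zeta(2r+1-2k)\\&+(-1)^{r-1}\frac{2^{2r+1}\pi^{2r}}{(2^{4r+1}+2^{2r}-1)(2r)!}\left(H_{2r}-\ln\frac{\pi}{2}\right)\\&+(-1)^{r-1}\frac{2^{2r}\pi^{2r}}{2^{4r+1}+2^{2r}-1}\sum_{k=1}^\infty\frac1k\frac{B_k^*}{(2r+2k)!}\left(\frac{\pi}{2}\right)^{2k},\end{aligned}$$ or, equivalently, $$\begin{aligned}\zeta(2r+1)=\ &\frac{2^{4r+1}}{2^{4r+1}+2^{2r}-1}\sum_{k=1}^{r-1}(-1)^{k-1}\frac{1}{(2k)!}\left(\frac{\pi}{2}\right)^{2k}\zeta(2r+1-2k)\\&+(-1)^{r-1}\frac{2^{2r+1}\pi^{2r}}{(2^{4r+1}+2^{2r}-1)(2r)!}\left(H_{2r}-\ln\frac{\pi}{2}\right)\\&+(-1)^{r-1}\frac{2^{2r+1}\pi^{2r}}{2^{4r+1}+2^{2r}-1}\sum_{k=1}^\infty\frac{(2k)!}{4^{2k}(2r+2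k)!\,k}\zeta(2k).\end{aligned}$$
   Context: $H_m=\sum_{j=1}^m 1/j$ are the harmonic numbers. The Bernoulli numbers $B_k^*$ are in the positive convention ($B_1^*=1/6$, $B_2^*=1/30$, ...; in modern notation $B_k^*=|B_{2k}|$). An empty sum is $0$. *)

(* Defs.v *)
From Stdlib Require Import Reals Lra Lia Arith.
From Coquelicot Require Import Coquelicot.
Open Scope R_scope.

(* Dirichlet series of the Riemann zeta function at a real argument; meaningful
   only for [s > 1], the series (hence its total [Series]) being junk elsewhere. *)
Definition zeta (s : R) : R := Series (fun n => / Rpower (INR (S n)) s).

Definition harmonic (n : nat) : R := sum_n_m (fun j => / INR j) 1 n.

(* [bernoulli_upto n] tabulates B_0, ..., B_n (its values beyond n are
   irrelevant); the entry [S n] is obtained by solving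
   sum_{j <= n+1} binom (n+2) j B_j = 0 for B_{n+1}.
   [Binomial.C] is qualified because Coquelicot's [C] is the complex field. *)
Fixpoint bernoulli_upto (n : nat) : nat -> R :=
  match n with
  | O => fun _ => 1
  | S m => fun j =>
      if (j <=? m)%nat then bernoulli_upto m j
      else - / INR (m + 2) *
           sum_n (fun i => Binomial.C (m + 2) i * bernoulli_upto m i) m
  end.

Definition bernoulli (n : nat) : R := bernoulli_upto n n.

Lemma bernoulli_uptoE (n j : nat) :
  (j <= n)%nat -> bernoulli_upto n j = bernoulli j.
Proof.
induction n as [|n IH]; intros Hj.
- now replace j with O by lia.
- destruct (Nat.eq_dec j (S n)) as [->|Hne]; [reflexivity|].
  simpl; rewrite (proj2 (Nat.leb_le j n)) by lia.
  apply IH; lia.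
Qed.

Lemma bernoulli_0 : bernoulli 0 = 1.
Proof. reflexivity. Qed.

Lemma bernoulli_rec (n : nat) : (1 <= n)%nat ->
  sum_n (fun j => Binomial.C (n + 1) j * bernoulli j) n = 0.
Proof.
intros Hn; destruct n as [|m]; [lia|].
replace (S m + 1)%nat with (m + 2)%nat by lia.
rewrite sum_Sn.
assert (HC : Binomial.C (m + 2) (S m) = INR (m + 2)).
{ rewrite pascal_step1 by lia.
  replace (m + 2 - S m)%nat with 1%nat by lia.
  replace (m + 2)%nat with (S (m + 1)) by lia.
  unfold Binomial.C; replace (S (m + 1) - 1)%nat with (m + 1)%nat by lia.
  rewrite fact_simpl, mult_INR; simpl (fact 1).
  change (INR 1) with 1.
  field; apply INR_fact_neq_0. }
rewrite HC.
assert (HB : bernoulli (S m) = - / INR (m + 2) *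
           sum_n (fun i => Binomial.C (m + 2) i * bernoulli i) m).
{ assert (Hlt : (S m <=? m)%nat = false) by (apply Nat.leb_gt; lia).
  unfold bernoulli at 1; cbn [bernoulli_upto]; rewrite Hlt.
  f_equal; apply sum_n_ext_loc; intros i Hi.
  now rewrite bernoulli_uptoE by lia. }
rewrite HB; unfold plus; simpl.
field; apply not_0_INR; lia.
Qed.

(* B_1 = -1/2 is skipped and signs are dropped: 1/6, 1/30, 1/42, ... for k >= 1. *)
Definition Bstar (k : nat) : R := Rabs (bernoulli (2 * k)).

(* Main.v *)
Require Import Defs.
From Stdlib Require Import Reals Lra Lia Arith.
From Coquelicot Require Import Coquelicot.
Open Scope R_scope.

(* Both trigonometric sums [sum cos (n x) / n = - ln (2 sin (x / 2))] and
   [sum sin (n x) / n = (PI - x) / 2] converge uniformly away from the multiples of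
   [2 PI], by the Dirichlet kernel and one integration by parts.  The first primitives
   of the partial sums are [O(sqrt x)] at 0 uniformly in the number of terms, so that
   convergence of all the iterated primitives from 0 follows from the mean value
   inequality alone, for finite sums, without any termwise integration.

   The sine sum, integrated and evaluated at [2 PI], gives the recurrence of the
   Bernoulli numbers for the values [zeta (2 k)], whence Euler's formula and the signs
   of the Bernoulli numbers.  The same recurrence, read as a Cauchy product of power
   series, gives the expansion of [(x / 2) cot (x / 2)], hence of [ln (2 sin (x / 2))],
   with coefficients in terms of [zeta (2 k)].  The cosine sum, integrated [2 r] times
   and evaluated at [PI / 2], is then the claimed formula, because
   [sum cos (n PI / 2) / n ^ s = (2 / 4 ^ s - 1 / 2 ^ s) zeta s]. *)

(** * Mean value estimates *)

(** The obstacle is the point 0: there the cosine sum has a logarithmic singularity and the sine sum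
    a jump, so neither converges uniformly on an interval starting at 0. Uniformity is gained only
    after one primitive: near 0 the primitives of the partial sum and of the limit are small
    independently of the number of terms, and away from 0 the error is carried along by the mean
    value inequality. The exponent 1/2 at 0 is a choice: [|sin y| <= y ^ a] with any [0 < a < 1]
    leaves a convergent series [sum n ^ (a - 2)] and a positive power of [x]. Constants of
    integration are fixed at [PI], where the sine sum is zero term by term and the cosine sum is an
    alternating harmonic series. At [PI / 2] the degree 0 term of the polynomial part again carries
    [zeta (2 r + 1)]. Together with the cosine sum it gives the coefficient
    [1 - 2 / 4 ^ s + 1 / 2 ^ s], [s = 2 r + 1], which is [(2 ^ (4 r + 1) + 2 ^ (2 r) - 1) / 2 ^ (4 r
    + 1)]. *)

Lemma is_series_sum_f_R0 (a : nat -> R) (l : R) :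
  is_series a l <-> is_lim_seq (sum_f_R0 a) l.
Proof.
rewrite is_lim_seq_Reals; apply is_series_Reals.
Qed.

Lemma is_derive_sum_f_R0 (f d : nat -> R -> R) (n : nat) (x : R) :
  (forall k, is_derive (f k) x (d k x)) ->
  is_derive (fun y => sum_f_R0 (fun k => f k y) n) x (sum_f_R0 (fun k => d k x) n).
Proof.
intros H; induction n as [|n IH]; simpl; [apply H|].
apply (is_derive_plus (fun y => sum_f_R0 (fun k => f k y) n) (f (S n))); [exact IH|apply H].
Qed.

Lemma mvt_bound (f df : R -> R) (a b B : R) : a <= b ->
  (forall x, a <= x <= b -> is_derive f x (df x)) ->
  (forall x, a <= x <= b -> Rabs (df x) <= B) ->
  Rabs (f b - f a) <= B * (b - a).
Proof.
intros Hab Hd HB.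
destruct (MVT_gen f a b df) as [c [Hc ->]];
  rewrite ?Rmin_left, ?Rmax_right in * by lra.
- intros x Hx; apply Hd; lra.
- intros x Hx; apply derivable_continuous_pt; exists (df x).
  apply is_derive_Reals, Hd; lra.
- rewrite Rabs_mult, (Rabs_pos_eq (b - a)) by lra.
  apply Rmult_le_compat_r; [lra|now apply HB].
Qed.

(** One-sided and blind to the value at 0, so that it applies to expressions containing [ln x]. *)
Definition vanishes_at_0 (f : R -> R) : Prop :=
  forall eps, 0 < eps -> exists d, 0 < d /\ forall x, 0 < x <= d -> Rabs (f x) <= eps.

Lemma vanishes_at_0_minus (f g : R -> R) :
  vanishes_at_0 f -> vanishes_at_0 g -> vanishes_at_0 (fun x => f x - g x).
Proof.
intros Hf Hg eps He.
destruct (Hf (eps / 2)) as [d1 [Hd1 H1]]; [lra|].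
destruct (Hg (eps / 2)) as [d2 [Hd2 H2]]; [lra|].
exists (Rmin d1 d2); split; [now apply Rmin_pos|].
intros x Hx; pose proof (Rmin_l d1 d2); pose proof (Rmin_r d1 d2).
pose proof (Rabs_triang (f x) (- g x)); rewrite Rabs_Ropp in *.
specialize (H1 x); specialize (H2 x); unfold Rminus; lra.
Qed.

Lemma vanishes_at_0_continuous (f : R -> R) :
  f 0 = 0 -> ex_derive f 0 -> vanishes_at_0 f.
Proof.
intros H0 Hd eps He.
assert (Hc := derivable_continuous_pt f 0 (ex_derive_Reals_0 f 0 Hd)).
destruct (Hc eps He) as [d [Hd0 H]].
exists (d / 2); split; [lra|]; intros x Hx.
assert (R_dist (f x) (f 0) < eps).
{ apply H; split; [split; [exact I|lra]|].
  simpl; unfold R_dist; rewrite Rabs_pos_eq; lra. }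
unfold R_dist in *; rewrite H0, Rminus_0_r in *; lra.
Qed.

(** No regularity at 0 is available, so the mean value inequality is applied on [[m, x]] with
    [m > 0] small, and [|f m|] is absorbed in an arbitrary [eps]. *)
Lemma vanishes_mvt_bound (f df : R -> R) (a B : R) :
  (forall x, 0 < x <= a -> is_derive f x (df x)) ->
  (forall x, 0 < x <= a -> Rabs (df x) <= B) ->
  vanishes_at_0 f ->
  forall x, 0 < x <= a -> Rabs (f x) <= B * x.
Proof.
intros Hd HB Hv x Hx; apply Rle_plus_epsilon; intros eps He.
assert (HB0 : 0 <= B) by (specialize (HB x Hx); pose proof (Rabs_pos (df x)); lra).
destruct (Hv eps He) as [d [Hd0 H]].
pose proof (Rmin_l d x); pose proof (Rmin_r d x); pose proof (Rmin_pos d x Hd0 (proj1 Hx)).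
set (m := Rmin d x) in *.
assert (Hfx : Rabs (f x - f m) <= B * (x - m)).
{ apply (mvt_bound f df); [lra| |]; intros y Hy; [apply Hd|apply HB]; lra. }
assert (Hfm : Rabs (f m) <= eps) by (apply H; lra).
pose proof (Rabs_triang (f x - f m) (f m)) as Ht.
replace (f x - f m + f m) with (f x) in Ht by ring.
nra.
Qed.

Lemma iterated_primitive_bound (D : nat -> R -> R) (a eps : R) : 0 <= a ->
  (forall m x, 0 < x <= a -> is_derive (D (S m)) x (D m x)) ->
  (forall m, vanishes_at_0 (D m)) ->
  (forall x, 0 < x <= a -> Rabs (D O x) <= eps) ->
  forall m x, 0 < x <= a -> Rabs (D m x) <= eps * a ^ m.
Proof.
intros Ha Hd Hv H0 m; induction m as [|m IH]; intros x Hx; simpl.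
- rewrite Rmult_1_r; now apply H0.
- pose proof (vanishes_mvt_bound (D (S m)) (D m) a (eps * a ^ m) (Hd m) IH (Hv (S m)) x Hx).
  assert (0 <= eps * a ^ m).
  { specialize (IH x Hx); pose proof (Rabs_pos (D m x)); lra. }
  nra.
Qed.

(** * Uniform convergence away from 0 and its transfer to primitives *)

(** Integration by parts without integrals: subtracting [U (w t) / (2 w sin (t / 2))] from [E]
    removes the oscillating factor [T] from the derivative and leaves a term of size [1 / w]. Both
    the correction and the variation of the corrected function are then [O(1 / w)], and the value at
    [PI] serves as the constant of integration. *)
Lemma oscillatory_bound (T U E : R -> R) (w d : R) : 1 <= w -> 0 < d <= PI ->
  (forall y, is_derive U y (T y)) -> (forall y, Rabs (U y) <= 1) ->
  (forall x, 0 < x <= PI -> is_derive E x (T (w * x) / (2 * sin (x / 2)))) ->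
  forall x, d <= x <= PI ->
    Rabs (E x) <= Rabs (E PI) + 4 / (w * sin (d / 2) ^ 2).
Proof.
intros Hw Hd HU HU1 HE x Hx.
pose proof PI_4 as HPI4.
assert (Hs0 : 0 < sin (d / 2)) by (apply sin_gt_0; lra).
pose proof (SIN_bound (d / 2)) as Hs1.
set (s := sin (d / 2)) in *.
assert (Hst : forall t, d <= t <= PI -> s <= sin (t / 2)).
{ intros t Ht; apply sin_incr_1; lra. }
set (W := fun t => E t - U (w * t) / (2 * w * sin (t / 2))).
set (dW := fun t => U (w * t) * cos (t / 2) / (4 * w * sin (t / 2) ^ 2)).
assert (Hdiff : Rabs (W PI - W x) <= / (4 * w * s ^ 2) * (PI - x)).
{ apply (mvt_bound W dW); [lra| |].
  - intros t Ht; assert (Hst' := Hst t ltac:(lra)).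
    unfold W, dW.
    evar_last.
    { apply (is_derive_minus E (fun t => U (w * t) / (2 * w * sin (t / 2)))).
      apply HE; lra.
      apply (is_derive_div (fun t => U (w * t)) (fun t => 2 * w * sin (t / 2))).
      - apply (is_derive_comp U (fun t => w * t)); [apply HU|].
        auto_derive; [exact I|reflexivity].
      - auto_derive; [exact I|reflexivity].
      - assert (0 < w * sin (t / 2)) by (apply Rmult_lt_0_compat; lra); lra. }
    unfold minus, plus, opp, scal; simpl; unfold mult; simpl.
    change (t * / 2) with (t / 2); field; split; lra.
  - intros t Ht; assert (Hst' := Hst t ltac:(lra)).
    unfold dW, Rdiv; rewrite !Rabs_mult.
    assert (Hss : s ^ 2 <= sin (t / 2) ^ 2) by (apply pow_incr; lra).
    assert (0 < s ^ 2) by (apply pow_lt; lra).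
    assert (w * s ^ 2 <= w * sin (t / 2) ^ 2) by (apply Rmult_le_compat_l; lra).
    assert (0 < w * s ^ 2) by (apply Rmult_lt_0_compat; lra).
    change (t * / 2) with (t / 2).
    rewrite (Rabs_pos_eq (/ _)) by (left; apply Rinv_0_lt_compat; lra).
    apply Rle_trans with (1 * 1 * / (4 * w * sin (t / 2) ^ 2)).
    + apply Rmult_le_compat_r; [left; apply Rinv_0_lt_compat; lra|].
      apply Rmult_le_compat; try apply Rabs_pos; [apply HU1|].
      apply Rabs_le, COS_bound.
    + rewrite !Rmult_1_l; apply Rinv_le_contravar; lra. }
assert (HWE : forall t, d <= t <= PI -> Rabs (E t - W t) <= / (2 * w * s ^ 2)).
{ intros t Ht; assert (Hst' := Hst t ltac:(lra)); unfold W.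
  replace (E t - (E t - _)) with (U (w * t) * / (2 * w * sin (t / 2))) by (unfold Rdiv; ring).
  assert (w * s ^ 2 <= w * sin (t / 2)) by (apply Rmult_le_compat_l; nra).
  assert (0 < w * s ^ 2) by (apply Rmult_lt_0_compat; [lra|apply pow_lt; lra]).
  rewrite Rabs_mult, (Rabs_pos_eq (/ _)) by (left; apply Rinv_0_lt_compat; lra).
  apply Rle_trans with (1 * / (2 * w * sin (t / 2))).
  - apply Rmult_le_compat_r; [left; apply Rinv_0_lt_compat; lra|apply HU1].
  - rewrite Rmult_1_l; apply Rinv_le_contravar; lra. }
pose proof (HWE x Hx) as H1; pose proof (HWE PI ltac:(lra)) as H2.
set (i := / (w * s ^ 2)).
assert (Hi : 0 < i) by (apply Rinv_0_lt_compat; apply Rmult_lt_0_compat; [lra|apply pow_lt; lra]).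
replace (/ (2 * w * s ^ 2)) with (i / 2) in * by (unfold i; field; lra).
replace (/ (4 * w * s ^ 2)) with (i / 4) in * by (unfold i; field; lra).
replace (4 / (w * s ^ 2)) with (4 * i) by (unfold i; field; lra).
(* The length [PI - x] is at most 4. Adding the two corrections [i / 2] gives [2 i], within the
   stated [4 i]. *)
assert (Hd' : Rabs (W PI - W x) <= i) by nra.
clear - H1 H2 Hd' Hi.
revert H1 H2 Hd'; unfold Rabs; repeat destruct Rcase_abs; lra.
Qed.

Lemma lim_seq_eps (u : nat -> R) (l : R) :
  is_lim_seq u l <->
  forall eps, 0 < eps -> exists N, forall n, (N <= n)%nat -> Rabs (u n - l) <= eps.
Proof.
rewrite is_lim_seq_Reals; split; intros H eps He.
- destruct (H eps He) as [N HN]; exists N; intros n Hn; left; now apply HN.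
- destruct (H (eps / 2)) as [N HN]; [lra|]; exists N; intros n Hn.
  unfold R_dist; specialize (HN n Hn); lra.
Qed.

(** Level 0 is controlled only on each [[d, a]], level 1 near 0 by an estimate uniform in [N].
    Cutting at [d] yields [e] from [(0, d]] and [e * a] from the mean value inequality beyond it,
    whence [e = eps / (1 + a)]. *)
Lemma primitive_unif_small (D : nat -> nat -> R -> R) (a : R) : 0 < a ->
  (forall N m x, 0 < x <= a -> is_derive (D N (S m)) x (D N m x)) ->
  (forall eps, 0 < eps -> exists d, 0 < d /\ forall N x, 0 < x <= d -> Rabs (D N 1%nat x) <= eps) ->
  (forall d eps, 0 < d <= a -> 0 < eps -> exists N0, forall N x, (N0 <= N)%nat ->
     d <= x <= a -> Rabs (D N 0%nat x) <= eps) ->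
  forall eps, 0 < eps -> exists N0, forall N x, (N0 <= N)%nat ->
    0 < x <= a -> Rabs (D N 1%nat x) <= eps.
Proof.
intros a_pos D_derive Hv H0 eps He.
set (e := eps / (1 + a)).
assert (He' : 0 < e) by (apply Rdiv_lt_0_compat; lra).
destruct (Hv e He') as [d' [Hd' Hv']].
set (d := Rmin d' a).
assert (Hd : 0 < d) by now apply Rmin_pos.
pose proof (Rmin_l d' a : d <= d') as Hl; pose proof (Rmin_r d' a : d <= a) as Hr.
destruct (H0 d e (conj Hd Hr) He') as [N0 HN]; exists N0; intros N x HNN Hx.
assert (Hea : eps = e + e * a) by (unfold e; field; lra).
destruct (Rle_dec x d) as [Hxd|Hxd].
- specialize (Hv' N x ltac:(lra)); nra.
- assert (Hb : Rabs (D N 1%nat x - D N 1%nat d) <= e * (x - d)).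
  { apply (mvt_bound (D N 1%nat) (D N 0%nat)); [lra| |]; intros y Hy.
    - apply D_derive; lra.
    - apply HN; [assumption|lra]. }
  specialize (Hv' N d ltac:(lra)).
  pose proof (Rabs_triang (D N 1%nat x - D N 1%nat d) (D N 1%nat d)) as Ht.
  replace (D N 1%nat x - D N 1%nat d + D N 1%nat d) with (D N 1%nat x) in Ht by ring.
  nra.
Qed.

(** The induction starts at level 1, the lowest one that is uniformly small up to 0; every further
    primitive costs a factor [a]. *)
Lemma iterated_primitive_lim (D : nat -> nat -> R -> R) (a : R) : 0 < a ->
  (forall N m x, 0 < x <= a -> is_derive (D N (S m)) x (D N m x)) ->
  (forall N m, vanishes_at_0 (D N (S m))) ->
  (forall eps, 0 < eps -> exists N0, forall N x, (N0 <= N)%nat ->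
    0 < x <= a -> Rabs (D N 1%nat x) <= eps) ->
  forall m x, 0 < x <= a -> is_lim_seq (fun N => D N (S m) x) 0.
Proof.
intros a_pos D_derive D_vanishes H m x Hx; apply lim_seq_eps; intros eps He.
assert (Hp : 0 < a ^ m) by now apply pow_lt.
destruct (H (eps / a ^ m)) as [N0 HN]; [now apply Rdiv_lt_0_compat|].
exists N0; intros N HNN; rewrite Rminus_0_r.
replace eps with (eps / a ^ m * a ^ m) by (field; lra).
apply (iterated_primitive_bound (fun k => D N (S k)) a); try lra; intros; auto.
Qed.

(** The frequency is [N + 3 / 2] because index [N] stands for the [N + 1] terms [n = 1, ..., N + 1],
    and the Dirichlet kernel adds one half. *)
Lemma oscillatory_lim (T U : R -> R) (E : nat -> R -> R) :
  (forall y, is_derive U y (T y)) -> (forall y, Rabs (U y) <= 1) ->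
  (forall N x, 0 < x <= PI ->
     is_derive (E N) x (T ((INR N + 3 / 2) * x) / (2 * sin (x / 2)))) ->
  is_lim_seq (fun N => E N PI) 0 ->
  forall d eps, 0 < d <= PI -> 0 < eps ->
  exists N0, forall N x, (N0 <= N)%nat -> d <= x <= PI -> Rabs (E N x) <= eps.
Proof.
intros HU HU1 HE Hlim d eps Hd He.
assert (Hs0 : 0 < sin (d / 2)) by (apply sin_gt_0; lra).
destruct (proj1 (lim_seq_eps _ _) Hlim (eps / 2)) as [N1 HN1]; [lra|].
set (q := 4 / sin (d / 2) ^ 2).
assert (Hq : 0 < q) by (apply Rdiv_lt_0_compat; [lra|now apply pow_lt]).
destruct (nfloor_ex (q / (eps / 2))) as [N2 HN2].
{ left; apply Rdiv_lt_0_compat; lra. }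
exists (N1 + N2)%nat; intros N x HN Hx.
pose proof (pos_INR N) as HN0.
pose proof (oscillatory_bound T U (E N) (INR N + 3 / 2) d ltac:(lra) Hd HU HU1 (HE N) x Hx) as Hb.
specialize (HN1 N ltac:(lia)); rewrite Rminus_0_r in HN1.
assert (HNN : INR N2 <= INR N) by (apply le_INR; lia).
replace (4 / ((INR N + 3 / 2) * sin (d / 2) ^ 2)) with (q / (INR N + 3 / 2)) in Hb
  by (unfold q; field; lra).
assert (q / (INR N + 3 / 2) <= eps / 2); [|lra].
apply Rle_div_l; [lra|].
destruct HN2 as [_ HN2]; apply Rlt_div_l in HN2; nra.
Qed.

(** * Iterated primitives of the trigonometric sums *)

(* [phi m] is the [m]-fold iterated primitive from 0 of the cosine. *)
Fixpoint phi (m : nat) (y : R) : R :=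
  match m with
  | O => cos y
  | S O => sin y
  | S (S p) => y ^ p / INR (fact p) - phi p y
  end.

Lemma phi_SS (p : nat) (y : R) : phi (S (S p)) y = y ^ p / INR (fact p) - phi p y.
Proof. reflexivity. Qed.

Lemma nat_ind2 (P : nat -> Prop) :
  P O -> P 1%nat -> (forall n, P n -> P (S (S n))) -> forall n, P n.
Proof.
intros H0 H1 HS n; enough (P n /\ P (S n)) by tauto.
induction n; intuition.
Qed.

Lemma is_derive_monomial (p : nat) (x : R) :
  is_derive (fun y => y ^ S p / INR (fact (S p))) x (x ^ p / INR (fact p)).
Proof.
rewrite fact_simpl, mult_INR.
assert (INR (S p) <> 0) by now apply not_0_INR.
pose proof (INR_fact_neq_0 p).
set (c := INR (S p)) in *.
auto_derive; [exact I|].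
change (match p with O => 1 | S _ => INR p + 1 end) with c.
field; split; assumption.
Qed.

Lemma is_derive_phi (m : nat) (y : R) : is_derive (phi (S m)) y (phi m y).
Proof.
induction m as [| |p IH] using nat_ind2.
- apply is_derive_sin.
- unfold phi; auto_derive; [exact I|]; simpl; field.
- apply (is_derive_minus (fun y => y ^ S p / INR (fact (S p))) (phi (S p)));
    [apply is_derive_monomial|exact IH].
Qed.

Lemma phi_S_0 (m : nat) : phi (S m) 0 = 0.
Proof.
induction m as [| |p IH] using nat_ind2.
- apply sin_0.
- simpl; rewrite cos_0; field.
- rewrite phi_SS, IH; simpl; unfold Rdiv; ring.
Qed.

(** Up to [PI], [sin y] lies between 0 and both 1 and [y], hence its square is at most [y]; beyond
    [PI] the right side exceeds 1. *)
Lemma abs_sin_le_sqrt (y : R) : 0 <= y -> Rabs (sin y) <= sqrt y.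
Proof.
intros Hy.
pose proof (SIN_bound y).
rewrite <- (sqrt_Rsqr_abs (sin y)); apply sqrt_le_1_alt; unfold Rsqr.
destruct (Rle_dec y PI) as [Hp|Hp].
- assert (0 <= sin y) by now apply sin_ge_0.
  assert (sin y <= y).
  { destruct (Req_dec y 0) as [->|]; [rewrite sin_0; lra|]; left; apply sin_lt_x; lra. }
  nra.
- pose proof PI2_1; nra.
Qed.

Lemma phi_1_2_le_sqrt (j : nat) (y : R) : (j <= 1)%nat -> 0 <= y ->
  Rabs (phi (1 + j) y) <= 2 * sqrt y.
Proof.
intros Hj Hy; pose proof (sqrt_pos y) as Hs.
destruct j as [|[|j]]; [| |lia]; simpl.
- pose proof (abs_sin_le_sqrt y Hy); lra.
- replace (1 / 1 - cos y) with (2 * (sin (y / 2) * sin (y / 2))).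
  2:{ replace (cos y) with (cos (2 * (y / 2))) by (f_equal; field); rewrite cos_2a_sin; field. }
  pose proof (abs_sin_le_sqrt (y / 2) ltac:(lra)) as H1.
  assert (sqrt (y / 2) <= sqrt y) by (apply sqrt_le_1_alt; lra).
  rewrite !Rabs_mult, (Rabs_pos_eq 2) by lra.
  pose proof (Rabs_pos (sin (y / 2))).
  assert (Rabs (sin (y / 2)) <= 1) by apply Rabs_le, SIN_bound.
  nra.
Qed.

(** With [j = 0] this is the [m]-fold primitive from 0 of the partial cosine sum, with [j = 1] that
    of the sine sum, the sine being [phi 1]. Each primitive divides the term by a further [n], hence
    the exponent [m + 1]. *)
Definition phi_sum (j N m : nat) (x : R) : R :=
  sum_f_R0 (fun n => phi (m + j) (INR (S n) * x) / INR (S n) ^ (m + 1)) N.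

Lemma INR_S_pos (n : nat) : 0 < INR (S n).
Proof. apply lt_0_INR; lia. Qed.

Lemma is_derive_phi_sum (j N m : nat) (x : R) :
  is_derive (phi_sum j N (S m)) x (phi_sum j N m x).
Proof.
apply (is_derive_sum_f_R0 (fun n x => phi (S m + j) (INR (S n) * x) / INR (S n) ^ (S m + 1))
  (fun n x => phi (m + j) (INR (S n) * x) / INR (S n) ^ (m + 1))).
intros n; pose proof (INR_S_pos n).
assert (Hc : is_derive (fun x => phi (S (m + j)) (INR (S n) * x)) x
               (INR (S n) * phi (m + j) (INR (S n) * x))).
{ apply (is_derive_comp (phi (S (m + j))) (fun x => INR (S n) * x)); [apply is_derive_phi|].
  set (c := INR (S n)); auto_derive; [exact I|ring]. }
evar_last; [exact (is_derive_scal_l _ x _ (/ INR (S n) ^ (S m + 1)) Hc)|].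
unfold scal; cbn -[INR pow phi]; unfold mult; cbn -[INR pow phi].
rewrite <- (tech_pow_Rmult _ (m + 1)).
generalize (phi (m + j) (INR (S n) * x)); intros u.
field; split; [apply pow_nonzero|]; lra.
Qed.

Lemma phi_sum_0 (j N m : nat) : phi_sum j N (S m) 0 = 0.
Proof.
apply sum_eq_R0; intros n _.
rewrite Rmult_0_r, Nat.add_succ_l, phi_S_0; unfold Rdiv; ring.
Qed.

Lemma phi_sum_vanishes (j N m : nat) : vanishes_at_0 (phi_sum j N (S m)).
Proof.
apply vanishes_at_0_continuous; [apply phi_sum_0|].
eexists; apply is_derive_phi_sum.
Qed.

(** The terms are [n ^ (- 3 / 2)], compared with the telescoping differences of [- 2 / sqrt n]. With
    [v ^ 2 = u ^ 2 + 1], [2 / u - 2 / v = 2 / (u v (u + v))], which is at least [1 / v ^ 3] because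
    [u < v]. *)
Lemma sum_inv_sqrt3 (N : nat) :
  sum_f_R0 (fun n => sqrt (INR (S n)) / INR (S n) ^ 2) N <= 3 - 2 / sqrt (INR (S N)).
Proof.
induction N as [|N IH].
- simpl; rewrite sqrt_1; right; field.
- rewrite tech5.
  assert (Ha : 0 < sqrt (INR (S N))) by (apply sqrt_lt_R0, INR_S_pos).
  assert (Hb : 0 < sqrt (INR (S (S N)))) by (apply sqrt_lt_R0, INR_S_pos).
  pose proof (sqrt_sqrt (INR (S N)) (Rlt_le _ _ (INR_S_pos N))) as Ha2.
  pose proof (sqrt_sqrt (INR (S (S N))) (Rlt_le _ _ (INR_S_pos (S N)))) as Hb2.
  rewrite <- Hb2 at 2.
  set (u := sqrt (INR (S N))) in *; set (v := sqrt (INR (S (S N)))) in *.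
  assert (Huv : v * v = u * u + 1) by (rewrite Ha2, Hb2; apply S_INR).
  enough (v / (v * v) ^ 2 <= 2 / u - 2 / v) by lra.
  replace (v / (v * v) ^ 2) with (/ (v * v * v)) by (field; lra).
  replace (2 / u - 2 / v) with (2 * (/ (u * v * (u + v)))).
  2:{ apply Rmult_eq_reg_l with (u * v * (u + v)); [|nra].
      transitivity (2 * (v * v - u * u)); [rewrite Huv; field; nra|field; lra]. }
  assert (u < v) by nra.
  replace (/ (v * v * v)) with (2 * / (v * v * (v + v))) by (field; lra).
  apply Rmult_le_compat_l; [lra|].
  apply Rinv_le_contravar.
  + apply Rmult_lt_0_compat; [now apply Rmult_lt_0_compat|lra].
  + apply Rmult_le_compat; try nra.
Qed.

(** Each term is at most [2 sqrt (n x) / n ^ 2], and [sum n ^ (- 3 / 2)] stays below 3. What matters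
    is that the bound does not involve [N]. *)
Lemma phi_sum_1_le (j N : nat) (x : R) : (j <= 1)%nat -> 0 <= x ->
  Rabs (phi_sum j N 1 x) <= 6 * sqrt x.
Proof.
intros Hj Hx; unfold phi_sum.
eapply Rle_trans; [apply Rsum_abs|].
apply Rle_trans with (sum_f_R0 (fun n => sqrt (INR (S n)) / INR (S n) ^ 2 * (2 * sqrt x)) N).
- apply sum_Rle; intros n _; pose proof (INR_S_pos n) as Hn.
  unfold Rdiv; rewrite Rabs_mult, (Rabs_pos_eq (/ _)).
  2: left; apply Rinv_0_lt_compat, pow_lt; lra.
  pose proof (phi_1_2_le_sqrt j (INR (S n) * x) Hj ltac:(nra)) as H.
  rewrite sqrt_mult in H by lra.
  replace (sqrt (INR (S n)) * / INR (S n) ^ 2 * (2 * sqrt x))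
    with (2 * (sqrt (INR (S n)) * sqrt x) * / INR (S n) ^ 2) by ring.
  apply Rmult_le_compat_r; [|exact H].
  left; apply Rinv_0_lt_compat, pow_lt; lra.
- rewrite <- scal_sum.
  pose proof (sum_inv_sqrt3 N).
  assert (0 < 2 / sqrt (INR (S N))) by (apply Rdiv_lt_0_compat; [lra|apply sqrt_lt_R0, INR_S_pos]).
  pose proof (sqrt_pos x); nra.
Qed.

Lemma sqrt_equi_small (C : R) : 0 < C -> forall eps, 0 < eps ->
  exists d, 0 < d /\ forall x, 0 < x <= d -> C * sqrt x <= eps.
Proof.
intros HC eps He; exists ((eps / C) ^ 2).
assert (0 < eps / C) by now apply Rdiv_lt_0_compat.
split; [now apply pow_lt|]; intros x Hx.
assert (sqrt x <= eps / C).
{ rewrite <- (sqrt_pow2 (eps / C)) by lra; apply sqrt_le_1_alt; lra. }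
replace eps with (C * (eps / C)) by (field; lra); nra.
Qed.

(** * The sine sum *)

(** The Dirichlet kernel: each product [2 sin (x / 2) cos (k x)] is a difference of sines at
    half-integer multiples, so the sum telescopes. The conjugate kernel for the sine sum follows in
    the same way. *)
Lemma two_sin_sum_cos (N : nat) (x : R) :
  2 * sin (x / 2) * (1 / 2 + sum_f_R0 (fun n => cos (INR (S n) * x)) N)
  = sin ((INR N + 3 / 2) * x).
Proof.
assert (H : forall k, 2 * sin (x / 2) * cos (k * x)
  = sin ((k + 1 / 2) * x) - sin ((k - 1 / 2) * x)).
{ intros k.
  replace ((k + 1 / 2) * x) with (k * x + x / 2) by field.
  replace ((k - 1 / 2) * x) with (k * x - x / 2) by field.
  rewrite sin_plus, sin_minus; ring. }
induction N as [|N IH].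
- simpl sum_f_R0; rewrite Rmult_plus_distr_l, H.
  replace ((1 - 1 / 2) * x) with (x / 2) by field.
  replace ((INR 0 + 3 / 2) * x) with ((1 + 1 / 2) * x) by (simpl; field).
  lra.
- rewrite tech5, <- Rplus_assoc, Rmult_plus_distr_l, IH, H, !S_INR.
  replace (INR N + 1 + 1 - 1 / 2) with (INR N + 3 / 2) by field.
  replace (INR N + 1 + 1 + 1 / 2) with (INR N + 1 + 3 / 2) by field.
  ring.
Qed.

Lemma two_sin_sum_sin (N : nat) (x : R) :
  2 * sin (x / 2) * sum_f_R0 (fun n => sin (INR (S n) * x)) N
  = cos (x / 2) - cos ((INR N + 3 / 2) * x).
Proof.
assert (H : forall k, 2 * sin (x / 2) * sin (k * x)
  = cos ((k - 1 / 2) * x) - cos ((k + 1 / 2) * x)).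
{ intros k.
  replace ((k + 1 / 2) * x) with (k * x + x / 2) by field.
  replace ((k - 1 / 2) * x) with (k * x - x / 2) by field.
  rewrite cos_plus, cos_minus; ring. }
induction N as [|N IH].
- simpl sum_f_R0; rewrite H.
  replace ((1 - 1 / 2) * x) with (x / 2) by field.
  replace ((INR 0 + 3 / 2) * x) with ((1 + 1 / 2) * x) by (simpl; field).
  reflexivity.
- rewrite tech5, Rmult_plus_distr_l, IH, H, !S_INR.
  replace (INR N + 1 + 1 - 1 / 2) with (INR N + 3 / 2) by field.
  replace (INR N + 1 + 1 + 1 / 2) with (INR N + 1 + 3 / 2) by field.
  ring.
Qed.

Lemma sin_half_pos (x : R) : 0 < x <= PI -> 0 < sin (x / 2).
Proof. intros Hx; apply sin_gt_0; lra. Qed.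

Lemma sin_INR_PI (n : nat) : sin (INR n * PI) = 0.
Proof.
induction n as [|n IH]; [simpl; rewrite Rmult_0_l; apply sin_0|].
rewrite S_INR, Rmult_plus_distr_r, Rmult_1_l, neg_sin, IH; ring.
Qed.

Lemma cos_INR_PI (n : nat) : cos (INR n * PI) = (-1) ^ n.
Proof.
induction n as [|n IH]; [simpl; rewrite Rmult_0_l; apply cos_0|].
rewrite S_INR, Rmult_plus_distr_r, Rmult_1_l, neg_cos, IH; simpl; ring.
Qed.

(* The [m]-fold iterated primitive from 0 of the sawtooth [(PI - x) / 2]. *)
Definition saw (m : nat) (x : R) : R :=
  PI / 2 * (x ^ m / INR (fact m)) - / 2 * (x ^ S m / INR (fact (S m))).

Lemma is_derive_saw (m : nat) (x : R) : is_derive (saw (S m)) x (saw m x).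
Proof.
apply (is_derive_minus (fun x => PI / 2 * (x ^ S m / INR (fact (S m))))
  (fun x => / 2 * (x ^ S (S m) / INR (fact (S (S m)))))).
- apply (is_derive_scal (fun x => x ^ S m / INR (fact (S m)))), is_derive_monomial.
- apply (is_derive_scal (fun x => x ^ S (S m) / INR (fact (S (S m))))), is_derive_monomial.
Qed.

Lemma saw_S_0 (m : nat) : saw (S m) 0 = 0.
Proof. unfold saw; rewrite !pow_ne_zero by lia; unfold Rdiv; ring. Qed.

Lemma saw_vanishes (m : nat) : vanishes_at_0 (saw (S m)).
Proof.
apply vanishes_at_0_continuous; [apply saw_S_0|eexists; apply is_derive_saw].
Qed.

Lemma sine_sum_unif (d eps : R) : 0 < d <= PI -> 0 < eps ->
  exists N0, forall N x, (N0 <= N)%nat -> d <= x <= PI ->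
    Rabs (phi_sum 1 N 0 x - saw 0 x) <= eps.
Proof.
apply (oscillatory_lim sin (fun y => - cos y) (fun N x => phi_sum 1 N 0 x - saw 0 x)).
- intros y; auto_derive; [exact I|ring].
- intros y; rewrite Rabs_Ropp; apply Rabs_le, COS_bound.
- intros N x Hx; pose proof (sin_half_pos x Hx) as Hs.
  rewrite <- two_sin_sum_cos.
  replace (2 * sin (x / 2) * _ / _)
    with (sum_f_R0 (fun n => cos (INR (S n) * x)) N - (- / 2)) by (field; lra).
  apply (is_derive_minus (phi_sum 1 N 0) (saw 0)).
  + apply (is_derive_sum_f_R0 (fun n x => phi 1 (INR (S n) * x) / INR (S n) ^ 1)
      (fun n x => cos (INR (S n) * x))).
    intros n; pose proof (INR_S_pos n); cbn [phi].
    set (c := INR (S n)) in *; clearbody c; auto_derive; [exact I|simpl; field; lra].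
  + unfold saw; simpl; auto_derive; [exact I|field].
(* At [PI] the sawtooth and all sines vanish, so the error there is exactly 0. *)
- apply is_lim_seq_ext with (fun _ => 0); [|apply is_lim_seq_const].
  intros N; unfold phi_sum.
  rewrite sum_eq_R0; [unfold saw; simpl; field|].
  intros n _; cbn [phi Nat.add]; rewrite sin_INR_PI; unfold Rdiv; ring.
Qed.

Lemma sine_sum_primitive_unif (eps : R) : 0 < eps ->
  exists N0, forall N x, (N0 <= N)%nat -> 0 < x <= PI ->
    Rabs (phi_sum 1 N 1 x - saw 1 x) <= eps.
Proof.
apply (primitive_unif_small (fun N m x => phi_sum 1 N m x - saw m x) PI PI_RGT_0).
- intros N m x _; apply (is_derive_minus (phi_sum 1 N (S m)) (saw (S m))).
  + apply is_derive_phi_sum.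
  + apply is_derive_saw.
- clear eps; intros eps He.
  destruct (sqrt_equi_small 6 ltac:(lra) (eps / 2) ltac:(lra)) as [d1 [Hd1 H1]].
  destruct (saw_vanishes 0 (eps / 2) ltac:(lra)) as [d2 [Hd2 H2]].
  exists (Rmin d1 d2); split; [now apply Rmin_pos|]; intros N x Hx.
  pose proof (Rmin_l d1 d2); pose proof (Rmin_r d1 d2).
  specialize (H1 x ltac:(lra)); specialize (H2 x ltac:(lra)).
  pose proof (phi_sum_1_le 1 N x ltac:(lia) ltac:(lra)).
  pose proof (Rabs_triang (phi_sum 1 N 1 x) (- saw 1 x)) as Ht.
  rewrite Rabs_Ropp in Ht; unfold Rminus; lra.
- apply sine_sum_unif.
Qed.

Lemma phi_2_period (n : nat) (x : R) :
  phi 2 (INR n * (2 * PI - x)) = phi 2 (INR n * x).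
Proof.
rewrite !phi_SS; cbn [phi pow]; f_equal.
replace (INR n * (2 * PI - x)) with (- (INR n * x) + 2 * INR n * PI) by ring.
now rewrite cos_period, cos_neg.
Qed.

(** Uniform smallness is known on [(0, PI]] only, while the evaluation takes place at [2 * PI]. Both
    first primitives are symmetric about [PI], which extends the estimate to the whole period. *)
Lemma sine_sum_primitive_reflect (N : nat) (x : R) :
  phi_sum 1 N 1 (2 * PI - x) - saw 1 (2 * PI - x) = phi_sum 1 N 1 x - saw 1 x.
Proof.
f_equal.
- apply sum_eq; intros n _; cbn [Nat.add]; now rewrite phi_2_period.
- unfold saw; simpl; field.
Qed.

Lemma sine_sum_primitive_lim (m : nat) :
  is_lim_seq (fun N => phi_sum 1 N (S m) (2 * PI)) (saw (S m) (2 * PI)).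
Proof.
pose proof PI_RGT_0 as HPI.
apply is_lim_seq_ext with
  (fun N => (phi_sum 1 N (S m) (2 * PI) - saw (S m) (2 * PI)) + saw (S m) (2 * PI)).
{ intros N; ring. }
replace (Finite (saw (S m) (2 * PI))) with (Finite (0 + saw (S m) (2 * PI)))
  by (f_equal; ring).
apply is_lim_seq_plus'; [|apply is_lim_seq_const].
apply (iterated_primitive_lim (fun N m x => phi_sum 1 N m x - saw m x) (2 * PI)); try lra.
- intros N k x _; apply (is_derive_minus (phi_sum 1 N (S k)) (saw (S k))).
  + apply is_derive_phi_sum.
  + apply is_derive_saw.
- intros N k; apply vanishes_at_0_minus; [apply phi_sum_vanishes|apply saw_vanishes].
- intros eps He; destruct (sine_sum_primitive_unif eps He) as [N0 HN].
  exists N0; intros N x HNN Hx.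
  destruct (Rle_dec x PI); [apply HN; [assumption|lra]|].
  rewrite <- sine_sum_primitive_reflect.
  (* The point [2 * PI] reflects to 0, outside [(0, PI]]; there both primitives are 0. *)
  destruct (Req_dec x (2 * PI)) as [->|].
  + rewrite Rminus_diag, phi_sum_0, saw_S_0, Rminus_0_r, Rabs_R0; lra.
  + apply HN; [assumption|lra].
Qed.

(** * Partial sums of the zeta series at integers *)

Definition zeta_sum (s N : nat) : R := sum_f_R0 (fun n => / INR (S n) ^ s) N.

Lemma inv_INR_S_pow_pos (n s : nat) : 0 < / INR (S n) ^ s.
Proof. apply Rinv_0_lt_compat, pow_lt, INR_S_pos. Qed.

(** Telescoping: for [n >= 2], [1 / n ^ s <= 1 / (n (n - 1)) = 1 / (n - 1) - 1 / n]. *)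
Lemma zeta_sum_le (s N : nat) : (2 <= s)%nat -> zeta_sum s N <= 2 - / INR (S N).
Proof.
intros Hs; unfold zeta_sum; induction N as [|N IH].
- simpl sum_f_R0; simpl INR; rewrite pow1; lra.
- rewrite tech5.
  enough (/ INR (S (S N)) ^ s <= / INR (S N) - / INR (S (S N))) by lra.
  rewrite (S_INR (S N)); pose proof (INR_S_pos N) as H.
  assert (H1 : 1 <= INR (S N)) by (rewrite S_INR; pose proof (pos_INR N); lra).
  set (u := INR (S N)) in *.
  replace (/ u - / (u + 1)) with (/ (u * (u + 1))) by (field; lra).
  apply Rinv_le_contravar; [nra|].
  apply Rle_trans with ((u + 1) ^ 2); [nra|].
  apply Rle_pow; [lra|assumption].
Qed.

Lemma zeta_sum_lim (s : nat) : (2 <= s)%nat ->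
  is_lim_seq (zeta_sum s) (zeta (INR s)).
Proof.
intros Hs.
assert (He : is_series (fun n => / INR (S n) ^ s) (zeta (INR s))).
{ unfold zeta; erewrite Series_ext.
  2:{ intros n; rewrite Rpower_pow by apply INR_S_pos; reflexivity. }
  apply Series_correct.
  destruct (ex_finite_lim_seq_incr (zeta_sum s) 2) as [l Hl].
  - intros n; unfold zeta_sum; rewrite tech5.
    pose proof (inv_INR_S_pow_pos (S n) s); lra.
  - intros n; pose proof (zeta_sum_le s n Hs).
    pose proof (Rinv_0_lt_compat _ (INR_S_pos n)); lra.
  - exists l; now apply is_series_sum_f_R0. }
now apply is_series_sum_f_R0 in He.
Qed.

Lemma zeta_bounds (s : nat) : (2 <= s)%nat -> 0 < zeta (INR s) <= 2.
Proof.
intros Hs; pose proof (zeta_sum_lim s Hs) as Hl; split.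
- apply Rlt_le_trans with 1; [lra|].
  apply (is_lim_seq_le (fun _ => 1) (zeta_sum s) 1 (zeta (INR s)));
    [|apply is_lim_seq_const|exact Hl].
  intros n; unfold zeta_sum; induction n as [|n IH].
  + simpl; rewrite pow1; lra.
  + rewrite tech5; pose proof (inv_INR_S_pow_pos (S n) s); lra.
- apply (is_lim_seq_le (zeta_sum s) (fun _ => 2) (zeta (INR s)) 2);
    [|exact Hl|apply is_lim_seq_const].
  intros n; pose proof (zeta_sum_le s n Hs).
  pose proof (Rinv_0_lt_compat _ (INR_S_pos n)); lra.
Qed.

(** * Bernoulli numbers and even zeta values *)

Lemma is_lim_seq_sum_f_R0 (u : nat -> nat -> R) (l : nat -> R) (q : nat) :
  (forall j, (j <= q)%nat -> is_lim_seq (fun N => u N j) (l j)) ->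
  is_lim_seq (fun N => sum_f_R0 (u N) q) (sum_f_R0 l q).
Proof.
intros H; induction q as [|q IH]; simpl.
- apply H; lia.
- apply is_lim_seq_plus'; [apply IH; intros; apply H; lia|apply H; lia].
Qed.

Lemma sum_f_R0_comm (u : nat -> nat -> R) (N q : nat) :
  sum_f_R0 (fun n => sum_f_R0 (u n) q) N = sum_f_R0 (fun j => sum_f_R0 (fun n => u n j) N) q.
Proof.
induction N as [|N IH]; [reflexivity|].
rewrite tech5, IH, <- sum_plus; apply sum_eq; intros j _; now rewrite tech5.
Qed.

Lemma sum_f_R0_S (f : nat -> R) (n : nat) :
  sum_f_R0 f (S n) = f O + sum_f_R0 (fun k => f (S k)) n.
Proof. now rewrite decomp_sum by lia. Qed.

Lemma sum_f_R0_even (f : nat -> R) (n : nat) : (forall k, f (S (2 * k)) = 0) ->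
  sum_f_R0 f (2 * n) = sum_f_R0 (fun k => f (2 * k)%nat) n.
Proof.
intros H; induction n as [|n IH]; [reflexivity|].
replace (2 * S n)%nat with (S (S (2 * n))) by lia.
rewrite !tech5, IH, H; replace (2 * S n)%nat with (S (S (2 * n))) by lia; ring.
Qed.

(* The derivatives of the cosine at 0. *)
Fixpoint cos_jet (i : nat) : R :=
  match i with
  | O => 1
  | S O => 0
  | S (S p) => - cos_jet p
  end.

Lemma cos_jet_SS (p : nat) : cos_jet (S (S p)) = - cos_jet p.
Proof. reflexivity. Qed.

Lemma cos_jet_even (k : nat) : cos_jet (2 * k) = (-1) ^ k.
Proof.
induction k as [|k IH]; [reflexivity|].
replace (2 * S k)%nat with (S (S (2 * k))) by lia.
rewrite cos_jet_SS, IH; simpl; ring.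
Qed.

Lemma cos_jet_odd (k : nat) : cos_jet (S (2 * k)) = 0.
Proof.
induction k as [|k IH]; [reflexivity|].
replace (S (2 * S k)) with (S (S (S (2 * k)))) by lia.
rewrite cos_jet_SS, IH; ring.
Qed.

(** The recursion of [phi] unrolled two steps at a time; at a multiple of [2 * PI] the final cosine
    is 1 and the final sine 0. [cos_jet] treats both parities at once: for even [q] the constant
    term [j = q] of the sum is cancelled by that cosine, for odd [q] it is 0. *)
Lemma phi_2PI (q n : nat) :
  phi (S (S q)) (2 * PI * INR n)
  = sum_f_R0 (fun j => cos_jet j * ((2 * PI * INR n) ^ (q - j) / INR (fact (q - j)))) q
    - cos_jet q.
Proof.
assert (Hs : sin (2 * PI * INR n) = 0).
{ replace (2 * PI * INR n) with (0 + 2 * INR n * PI) by ring.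
  rewrite sin_period; apply sin_0. }
assert (Hc : cos (2 * PI * INR n) = 1).
{ replace (2 * PI * INR n) with (0 + 2 * INR n * PI) by ring.
  rewrite cos_period; apply cos_0. }
set (y := 2 * PI * INR n) in *; clearbody y.
induction q as [| |q IH] using nat_ind2.
- simpl; rewrite Hc; field.
- simpl; rewrite Hs; field.
- rewrite phi_SS, IH, !sum_f_R0_S, cos_jet_SS.
  replace (sum_f_R0 (fun k => cos_jet (S (S k)) * _) q)
    with (- sum_f_R0 (fun j => cos_jet j * (y ^ (q - j) / INR (fact (q - j)))) q).
  + rewrite !Nat.sub_0_r; cbn [cos_jet]; ring.
  + rewrite <- (Rmult_1_l (sum_f_R0 _ q)), Ropp_mult_distr_l, scal_sum.
    apply sum_eq; intros j _; rewrite cos_jet_SS; simpl Nat.sub; ring.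
Qed.

Lemma phi_sum_2PI (q N : nat) :
  phi_sum 1 N (S q) (2 * PI)
  = sum_f_R0 (fun j => cos_jet j * ((2 * PI) ^ (q - j) / INR (fact (q - j)))
                       * zeta_sum (S (S j)) N) q
    - cos_jet q * zeta_sum (S (S q)) N.
Proof.
unfold phi_sum, zeta_sum.
rewrite (sum_eq _ (fun n => sum_f_R0 (fun j => cos_jet j * ((2 * PI) ^ (q - j)
    / INR (fact (q - j))) * / INR (S n) ^ S (S j)) q - cos_jet q * / INR (S n) ^ S (S q))).
- rewrite minus_sum; f_equal.
  + rewrite sum_f_R0_comm; apply sum_eq; intros j _.
    rewrite scal_sum; apply sum_eq; intros; ring.
  + rewrite scal_sum; apply sum_eq; intros; ring.
- intros n _; replace (S q + 1)%nat with (S (S q)) by lia.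
  rewrite (Rmult_comm (INR (S n))), phi_2PI.
  pose proof (INR_S_pos n) as Hn; set (c := INR (S n)) in *; clearbody c.
  unfold Rdiv at 1; rewrite Rmult_minus_distr_r; f_equal.
  rewrite Rmult_comm, scal_sum; apply sum_eq; intros j Hj.
  rewrite Rpow_mult_distr.
  replace (c ^ S (S q)) with (c ^ (q - j) * c ^ S (S j))
    by (rewrite <- pow_add; f_equal; lia).
  field; repeat split; try apply pow_nonzero; try apply INR_fact_neq_0; lra.
Qed.

(* Euler's closed form of [bernoulli (j + 2) / (j + 2)!]. *)
Definition bern_zeta (j : nat) : R :=
  2 * cos_jet j * zeta (INR (S (S j))) / (2 * PI) ^ S (S j).

(** The limit of the iterated sine sum at [2 * PI] is computed twice, from the polynomial values of
    [phi] and from the sawtooth; dividing by [(2 * PI) ^ (q + 2) / 2] removes all powers of [PI]. *)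
Lemma bern_zeta_rec_aux (q : nat) :
  sum_f_R0 (fun j => bern_zeta j / INR (fact (q - j))) q - bern_zeta q
  = / (2 * INR (fact (S q))) - / INR (fact (S (S q))).
Proof.
pose proof PI_RGT_0 as HPI.
assert (Hl : is_lim_seq (fun N => phi_sum 1 N (S q) (2 * PI))
  (sum_f_R0 (fun j => cos_jet j * ((2 * PI) ^ (q - j) / INR (fact (q - j)))
                       * zeta (INR (S (S j)))) q - cos_jet q * zeta (INR (S (S q))))).
{ apply is_lim_seq_ext with (1 := fun N => eq_sym (phi_sum_2PI q N)).
  apply is_lim_seq_minus'.
  - apply (is_lim_seq_sum_f_R0 (fun N j => cos_jet j * ((2 * PI) ^ (q - j) /
       INR (fact (q - j))) * zeta_sum (S (S j)) N)).
    intros j Hj; apply is_lim_seq_mult'; [apply is_lim_seq_const|].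
    apply zeta_sum_lim; lia.
  - apply is_lim_seq_mult'; [apply is_lim_seq_const|apply zeta_sum_lim; lia]. }
pose proof (sine_sum_primitive_lim q) as Hl'.
apply is_lim_seq_unique in Hl, Hl'; rewrite Hl in Hl'.
apply Rbar_finite_eq in Hl'; rename Hl' into He.
assert (Hp : (2 * PI) ^ S (S q) <> 0) by (apply pow_nonzero; lra).
apply Rmult_eq_reg_l with ((2 * PI) ^ S (S q) / 2); [|lra].
transitivity (saw (S q) (2 * PI)).
- rewrite <- He, Rmult_minus_distr_l; f_equal.
  + rewrite scal_sum; apply sum_eq; intros j Hj; unfold bern_zeta.
    replace ((2 * PI) ^ S (S q)) with ((2 * PI) ^ (q - j) * (2 * PI) ^ S (S j))
      by (rewrite <- pow_add; f_equal; lia).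
    generalize (zeta (INR (S (S j)))) (INR_fact_neq_0 (q - j))
      (pow_nonzero (2 * PI) (S (S j)) ltac:(lra)); intros z Hf Hj'.
    set (P := (2 * PI) ^ S (S j)) in *; clearbody P; field; split; assumption.
  + unfold bern_zeta; generalize dependent ((2 * PI) ^ S (S q)); intros.
    generalize (zeta (INR (S (S q)))); intros; field; assumption.
- unfold saw; rewrite <- (tech_pow_Rmult _ (S q)).
  field; split; apply INR_fact_neq_0.
Qed.

Lemma bern_zeta_rec (q : nat) :
  sum_f_R0 (fun j => bern_zeta j / INR (fact (S q - j))) q
  = / (2 * INR (fact (S (S q)))) - / INR (fact (S (S (S q)))).
Proof.
rewrite <- (bern_zeta_rec_aux (S q)), tech5, Nat.sub_diag; simpl (fact 0); simpl INR.
field.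
Qed.

Lemma bernoulli_1 : bernoulli 1 = - / 2.
Proof.
pose proof (bernoulli_rec 1 ltac:(lia)) as H.
rewrite sum_n_Reals in H; simpl in H; unfold Binomial.C in H; simpl in H.
change (bernoulli 0) with 1 in H; lra.
Qed.

(** The defining recurrence divided by [(q + 3)!], with the terms of [B_0 = 1] and [B_1 = - 1 / 2]
    moved to the right. It has the same shape and right side as [bern_zeta_rec]. *)
Lemma bernoulli_fact_rec (q : nat) :
  sum_f_R0 (fun j => bernoulli (S (S j)) / INR (fact (S (S j))) / INR (fact (S q - j))) q
  = / (2 * INR (fact (S (S q)))) - / INR (fact (S (S (S q)))).
Proof.
pose proof (bernoulli_rec (S (S q)) ltac:(lia)) as H.
rewrite sum_n_Reals, !sum_f_R0_S, bernoulli_1, bernoulli_0 in H.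
replace (S (S q) + 1)%nat with (S (S (S q))) in H by lia.
apply Rmult_eq_reg_l with (INR (fact (S (S (S q))))); [|apply INR_fact_neq_0].
replace (sum_f_R0 (fun k => _ * bernoulli (S (S k))) q) with
  (INR (fact (S (S (S q)))) * sum_f_R0 (fun j => bernoulli (S (S j)) / INR (fact (S (S j)))
     / INR (fact (S q - j))) q) in H.
- replace (Binomial.C (S (S (S q))) 0) with 1 in H
    by (unfold Binomial.C; rewrite Nat.sub_0_r; simpl (fact 0); simpl (INR 1); field; apply INR_fact_neq_0).
  unfold Binomial.C in H; simpl (fact 1) in H; simpl (INR 1) in H.
  replace (S (S (S q)) - 1)%nat with (S (S q)) in H by lia.
  set (u := _ * sum_f_R0 _ _) in *.
  assert (HF := INR_fact_neq_0 (S (S q))); assert (HG := INR_fact_neq_0 (S (S (S q)))).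
  set (F := INR (fact (S (S q)))) in *; set (G := INR (fact (S (S (S q))))) in *.
  clearbody F G u; transitivity (G / (2 * F) - 1); [|field; split; assumption].
  replace (G / (1 * F) * - / 2) with (- (G / (2 * F))) in H by (field; assumption); lra.
- rewrite scal_sum; apply sum_eq; intros j Hj; unfold Binomial.C.
  replace (S (S (S q)) - S (S j))%nat with (S q - j)%nat by lia.
  field; split; apply INR_fact_neq_0.
Qed.

(** Both sequences solve the same triangular recurrence, whose last coefficient is [1 / 1!], so
    strong induction identifies them. This is Euler's formula. *)
Lemma bernoulli_bern_zeta (j : nat) :
  bernoulli (S (S j)) / INR (fact (S (S j))) = bern_zeta j.
Proof.
induction j as [q IH] using (well_founded_induction lt_wf).
pose proof (bernoulli_fact_rec q) as H; rewrite <- bern_zeta_rec in H.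
destruct q as [|q].
- cbn [sum_f_R0 Nat.sub] in H; change (INR (fact 1)) with 1 in H; lra.
- rewrite !tech5, (sum_eq _ (fun j => bern_zeta j / INR (fact (S (S q) - j)))) in H.
  + replace (S (S q) - S q)%nat with 1%nat in H by lia.
    change (INR (fact 1)) with 1 in H; lra.
  + intros j Hj; now rewrite IH by lia.
Qed.

Lemma bern_zeta_even (k : nat) :
  bern_zeta (2 * k) = 2 * (-1) ^ k * zeta (INR (2 * S k)) / (2 * PI) ^ (2 * S k).
Proof.
unfold bern_zeta; rewrite cos_jet_even.
now replace (2 * S k)%nat with (S (S (2 * k))) by lia.
Qed.

Lemma bern_zeta_odd (k : nat) : bern_zeta (S (2 * k)) = 0.
Proof. unfold bern_zeta; rewrite cos_jet_odd; unfold Rdiv; ring. Qed.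

Lemma bernoulli_even_zeta (k : nat) :
  bernoulli (2 * S k) = (-1) ^ k * (2 * INR (fact (2 * S k)) * zeta (INR (2 * S k))
    / (2 * PI) ^ (2 * S k)).
Proof.
replace (2 * S k)%nat with (S (S (2 * k))) at 1 by lia.
pose proof (bernoulli_bern_zeta (2 * k)) as H; rewrite bern_zeta_even in H.
replace (S (S (2 * k))) with (2 * S k)%nat in * by lia.
pose proof (INR_fact_neq_0 (2 * S k)) as Hf.
apply Rmult_eq_reg_r with (/ INR (fact (2 * S k))); [|now apply Rinv_neq_0_compat].
unfold Rdiv in H; rewrite H; field; split; [assumption|].
apply pow_nonzero; pose proof PI_RGT_0; lra.
Qed.

Lemma Bstar_zeta (k : nat) :
  Bstar (S k) = 2 * INR (fact (2 * S k)) * zeta (INR (2 * S k)) / (2 * PI) ^ (2 * S k).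
Proof.
unfold Bstar; rewrite bernoulli_even_zeta, Rabs_mult, pow_1_abs, Rmult_1_l.
apply Rabs_pos_eq; left; apply Rdiv_lt_0_compat.
- pose proof (proj1 (zeta_bounds (2 * S k) ltac:(lia))).
  pose proof (INR_fact_lt_0 (2 * S k)).
  apply Rmult_lt_0_compat; lra.
- apply pow_lt; pose proof PI_RGT_0; lra.
Qed.

Lemma bern_zeta_Bstar (k : nat) :
  bern_zeta (2 * k) = (-1) ^ k * (Bstar (S k) / INR (fact (2 * S k))).
Proof.
rewrite bern_zeta_even, Bstar_zeta.
pose proof (INR_fact_neq_0 (2 * S k)) as Hf.
field; split; [|assumption].
apply pow_nonzero; pose proof PI_RGT_0; lra.
Qed.

(** The lower index of the binomial is one less than the index of the Bernoulli number, so after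
    division by factorials the terms carry an extra weight [j + 2]. This weight is produced by
    combining [bern_zeta_rec] and [bern_zeta_rec_aux] at the odd index [q = 2 s - 1], where
    [bern_zeta q] vanishes. *)
Lemma Bstar_recurrence (s : nat) : (1 <= s)%nat ->
  sum_n_m (fun k => (-1) ^ k * Binomial.C (2 * s + 1) (2 * k + 1) * Bstar (k + 1))
    0 (s - 1) = 1 / 2.
Proof.
intros Hs; destruct s as [|t]; [lia|]; clear Hs.
replace (S t - 1)%nat with t by lia.
change (sum_n_m ?f 0 t) with (sum_n f t); rewrite sum_n_Reals.
set (q := S (2 * t)).
assert (Hw : sum_f_R0 (fun j => INR (S (S j)) * bern_zeta j / INR (fact (S q - j))) q
             = / (2 * INR (fact (S (S q))))).
{ pose proof (bern_zeta_rec q) as H1; pose proof (bern_zeta_rec_aux q) as H2.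
  rewrite (bern_zeta_odd t : bern_zeta q = 0) in H2.
  (* Termwise [j + 2 = (q + 3) - (q + 1 - j)], and the factor [q + 1 - j] cancels against
     [(q + 1 - j)!]. *)
  transitivity (INR (S (S (S q))) * sum_f_R0 (fun j => bern_zeta j / INR (fact (S q - j))) q
    - sum_f_R0 (fun j => bern_zeta j / INR (fact (q - j))) q).
  - rewrite scal_sum, <- minus_sum; apply sum_eq; intros j Hj.
    replace (S q - j)%nat with (S (q - j)) by lia.
    rewrite fact_simpl, mult_INR.
    replace (INR (S (S (S q)))) with (INR (S (S j)) + INR (S (q - j)))
      by (rewrite <- plus_INR; f_equal; lia).
    pose proof (INR_S_pos (q - j)); pose proof (INR_fact_neq_0 (q - j)).
    set (u := INR (S (q - j))) in *; set (v := INR (S (S j))); clearbody u v.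
    field; split; [assumption|lra].
  - rewrite H1; rewrite Rminus_0_r in H2; rewrite H2.
    rewrite (fact_simpl (S (S q))), (fact_simpl (S q)), !mult_INR, (S_INR (S (S q))).
    pose proof (INR_S_pos (S q)); pose proof (INR_fact_neq_0 (S q)).
    set (u := INR (S (S q))) in *; clearbody u; field; repeat split; try assumption; lra. }
rewrite (tech5 _ (2 * t) : sum_f_R0 _ q = _) in Hw; rewrite (bern_zeta_odd t : bern_zeta (S (2 * t)) = 0) in Hw.
rewrite sum_f_R0_even in Hw.
2:{ intros k; rewrite bern_zeta_odd; unfold Rdiv; ring. }
apply Rmult_eq_reg_r with (/ INR (fact (S (S q)))).
2: apply Rinv_neq_0_compat, INR_fact_neq_0.
transitivity (/ (2 * INR (fact (S (S q))))).
2: field; apply INR_fact_neq_0.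
rewrite <- Hw, Rmult_comm, scal_sum, Rmult_0_r, Rdiv_0_l, Rplus_0_r.
apply sum_eq; intros k Hk; rewrite bern_zeta_Bstar.
replace (2 * S t + 1)%nat with (S (S q)) by (unfold q; lia).
unfold Binomial.C.
replace (S (S q) - (2 * k + 1))%nat with (S q - 2 * k)%nat by lia.
replace (k + 1)%nat with (S k) by lia.
replace (2 * S k)%nat with (S (2 * k + 1)) by lia.
replace (S (S (2 * k))) with (S (2 * k + 1)) by lia.
rewrite (fact_simpl (2 * k + 1)), mult_INR.
pose proof (INR_S_pos (2 * k + 1)).
set (u := INR (S (2 * k + 1))) in *; clearbody u.
field; repeat split; try apply INR_fact_neq_0; lra.
Qed.

(** * Expansion of the cotangent and of the logarithm of the sine *)

(* The coefficients of [(x / 2) cot (x / 2)] in powers of [x ^ 2]. *)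
Definition cot_coef (k : nat) : R :=
  match k with
  | O => 1
  | S _ => - 2 * zeta (INR (2 * k)) / (2 * PI) ^ (2 * k)
  end.

Lemma cot_coef_S (k : nat) : cot_coef (S k) = - ((-1) ^ k * bern_zeta (2 * k)).
Proof.
unfold cot_coef; rewrite bern_zeta_even.
replace ((-1) ^ k * (2 * (-1) ^ k * zeta (INR (2 * S k)) / (2 * PI) ^ (2 * S k)))
  with (((-1) * (-1)) ^ k * (2 * zeta (INR (2 * S k)) / (2 * PI) ^ (2 * S k)))
  by (rewrite Rpow_mult_distr; unfold Rdiv; ring).
replace (-1 * -1) with 1 by ring; rewrite pow1; unfold Rdiv; ring.
Qed.

Lemma pow_m1_sub (n k : nat) : (k <= n)%nat -> (-1) ^ k * (-1) ^ (n - k) = (-1) ^ n.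
Proof. intros H; rewrite <- pow_add; f_equal; lia. Qed.

(** The coefficients of the identity [(x / 2) cot (x / 2) * (sin x / x) = (1 + cos x) / 2], obtained
    from the even part of the Bernoulli recurrence. *)
Lemma cot_coef_conv (n : nat) :
  sum_f_R0 (fun k => cot_coef k * ((-1) ^ (n - k) / INR (fact (2 * (n - k) + 1)))) n
  = match n with O => 1 | S _ => (-1) ^ n / (2 * INR (fact (2 * n))) end.
Proof.
destruct n as [|m]; [simpl; field|].
rewrite sum_f_R0_S, Nat.sub_0_r.
pose proof (bern_zeta_rec (2 * m)) as H.
rewrite sum_f_R0_even in H.
2:{ intros k; rewrite bern_zeta_odd; unfold Rdiv; ring. }
rewrite (sum_eq _ (fun k => bern_zeta (2 * k) / INR (fact (S (2 * m) - 2 * k)) * (-1) ^ S m)).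
- rewrite <- scal_sum, H.
  replace (S (S (2 * m))) with (2 * S m)%nat by lia.
  replace (S (2 * S m)) with (2 * S m + 1)%nat by lia.
  pose proof (INR_fact_neq_0 (2 * S m)); pose proof (INR_fact_neq_0 (2 * S m + 1)).
  set (u := INR (fact (2 * S m))) in *; set (v := INR (fact (2 * S m + 1))) in *.
  clearbody u v; unfold cot_coef; field; split; assumption.
- intros k Hk; rewrite cot_coef_S.
  replace (S m - S k)%nat with (m - k)%nat by lia.
  replace (2 * (m - k) + 1)%nat with (S (2 * m) - 2 * k)%nat by lia.
  rewrite <- (tech_pow_Rmult _ m), <- (pow_m1_sub m k Hk).
  unfold Rdiv; ring.
Qed.

Lemma is_series_sinc (x : R) : x <> 0 ->
  is_series (fun k => (-1) ^ k / INR (fact (2 * k + 1)) * x ^ (2 * k)) (sin x / x).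
Proof.
intros Hx; apply is_series_Reals.
unfold sin; destruct (exist_sin (Rsqr x)) as [a Ha].
replace (x * a / x) with a by (field; assumption).
intros eps He; destruct (Ha eps He) as [N HN]; exists N; intros n Hn.
rewrite (sum_eq _ (fun i => sin_n i * Rsqr x ^ i)); [now apply HN|].
intros i _; unfold sin_n; rewrite pow_mult, Rsqr_pow2; reflexivity.
Qed.

Lemma is_series_cos (x : R) :
  is_series (fun k => (-1) ^ k / INR (fact (2 * k)) * x ^ (2 * k)) (cos x).
Proof.
apply is_series_Reals.
unfold cos; destruct (exist_cos (Rsqr x)) as [a Ha].
intros eps He; destruct (Ha eps He) as [N HN]; exists N; intros n Hn.
rewrite (sum_eq _ (fun i => cos_n i * Rsqr x ^ i)); [now apply HN|].
intros i _; unfold cos_n; rewrite pow_mult, Rsqr_pow2; reflexivity.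
Qed.

Lemma ex_series_sinc_abs (x : R) :
  ex_series (fun k => Rabs ((-1) ^ k / INR (fact (2 * k + 1)) * x ^ (2 * k))).
Proof.
destruct (exist_exp (x ^ 2)) as [l Hl].
apply (ex_series_le (V := R_CompleteNormedModule) _ (fun k => / INR (fact k) * (x ^ 2) ^ k)).
2: exists l; now apply is_series_Reals.
intros k; unfold norm; simpl; unfold abs; simpl.
change (k + (k + 0))%nat with (2 * k)%nat.
rewrite Rabs_Rabsolu, pow_mult; unfold Rdiv.
rewrite !Rabs_mult, pow_1_abs, Rmult_1_l, (Rabs_pos_eq (/ _)).
2: left; apply Rinv_0_lt_compat, INR_fact_lt_0.
rewrite Rabs_pos_eq by (apply pow_le, pow2_ge_0).
apply Rmult_le_compat_r; [apply pow_le, pow2_ge_0|].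
apply Rinv_le_contravar; [apply INR_fact_lt_0|].
apply le_INR, fact_le; lia.
Qed.

Lemma cot_coef_bound (k : nat) : Rabs (cot_coef k) <= 4 / (2 * PI) ^ (2 * k).
Proof.
assert (Hp : 0 < (2 * PI) ^ (2 * k)) by (apply pow_lt; pose proof PI_RGT_0; lra).
destruct k as [|k].
- simpl; rewrite Rabs_R1; lra.
- unfold cot_coef, Rdiv; pose proof (zeta_bounds (2 * S k) ltac:(lia)) as Hz.
  rewrite !Rabs_mult, (Rabs_left (-2)) by lra.
  rewrite (Rabs_pos_eq (zeta _)) by lra.
  rewrite Rabs_pos_eq by (left; now apply Rinv_0_lt_compat).
  apply Rmult_le_compat_r; [left; now apply Rinv_0_lt_compat|lra].
Qed.

Lemma cot_term_bound (k : nat) (x : R) :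
  Rabs (cot_coef k * x ^ (2 * k)) <= 4 * ((x / (2 * PI)) ^ 2) ^ k.
Proof.
pose proof PI_RGT_0 as HP.
rewrite Rabs_mult, <- pow_mult; unfold Rdiv; rewrite Rpow_mult_distr, pow_inv.
rewrite (Rabs_pos_eq (x ^ _)) by (rewrite pow_mult; apply pow_le, pow2_ge_0).
replace (4 * (x ^ (2 * k) * / (2 * PI) ^ (2 * k)))
  with (4 / (2 * PI) ^ (2 * k) * x ^ (2 * k)) by (unfold Rdiv; ring).
apply Rmult_le_compat_r; [rewrite pow_mult; apply pow_le, pow2_ge_0|apply cot_coef_bound].
Qed.

(** At the end point [PI / 2] the ratio to [2 * PI] is 1/4: this is the source of every geometric
    factor 1/16 below. *)
Lemma ratio_bound (x : R) : 0 < x <= PI / 2 -> 0 <= (x / (2 * PI)) ^ 2 <= / 16.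
Proof.
intros Hx; split; [apply pow2_ge_0|].
assert (0 <= x / (2 * PI) <= / 4); [|nra].
split.
- left; apply Rdiv_lt_0_compat; lra.
- apply Rle_div_l; lra.
Qed.

Lemma ex_series_cot_abs (x : R) : 0 < x <= PI / 2 ->
  ex_series (fun k => Rabs (cot_coef k * x ^ (2 * k))).
Proof.
intros Hx; pose proof (ratio_bound x Hx) as Ht.
apply (ex_series_le (V := R_CompleteNormedModule) _
  (fun k => 4 * ((x / (2 * PI)) ^ 2) ^ k)).
- intros k; unfold norm; simpl; unfold abs; simpl; rewrite Rabs_Rabsolu.
  apply cot_term_bound.
- apply (ex_series_scal_l (V := R_NormedModule)), ex_series_geom; rewrite Rabs_pos_eq; lra.
Qed.

(** The series converges absolutely to some [l]; the Cauchy product with [sin x / x] gives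
    [l * (sin x / x) = (1 + cos x) / 2], and dividing by the nonzero [sin x / x] determines [l]. *)
Lemma is_series_cot (x : R) : 0 < x <= PI / 2 ->
  is_series (fun k => cot_coef k * x ^ (2 * k)) (x * cos (x / 2) / (2 * sin (x / 2))).
Proof.
intros Hx; pose proof (ex_series_cot_abs x Hx) as Habs.
destruct (ex_series_Rabs _ Habs) as [l Hl].
assert (Hprod := is_series_mult _ _ _ _ Hl (is_series_sinc x ltac:(lra)) Habs
  (ex_series_sinc_abs x)).
assert (Hcos : is_series (fun n => match n with O => 1 | S _ =>
   (-1) ^ n / (2 * INR (fact (2 * n))) end * x ^ (2 * n)) ((1 + cos x) / 2)).
{ apply is_series_sum_f_R0.
  apply is_lim_seq_ext with
    (fun n => / 2 * (1 + sum_f_R0 (fun k => (-1) ^ k / INR (fact (2 * k)) * x ^ (2 * k)) n)).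
  - intros n; induction n as [|n IH]; [simpl; field|].
    rewrite !tech5, <- IH; field; apply INR_fact_neq_0.
  - replace ((1 + cos x) / 2) with (/ 2 * (1 + cos x)) by field.
    apply is_lim_seq_mult'; [apply is_lim_seq_const|].
    apply is_lim_seq_plus'; [apply is_lim_seq_const|].
    apply is_series_sum_f_R0, is_series_cos. }
assert (He : l * (sin x / x) = (1 + cos x) / 2).
{ rewrite <- (is_series_unique _ _ Hprod), <- (is_series_unique _ _ Hcos).
  apply Series_ext; intros n; rewrite <- cot_coef_conv, Rmult_comm, scal_sum.
  apply sum_eq; intros k Hk.
  replace (2 * n)%nat with (2 * k + 2 * (n - k))%nat by lia; rewrite pow_add; ring. }
replace (x * cos (x / 2) / (2 * sin (x / 2))) with l; [exact Hl|].
assert (Hs : 0 < sin (x / 2)) by (apply sin_gt_0; pose proof PI_RGT_0; lra).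
assert (Hc : 0 < cos (x / 2)) by (apply cos_gt_0; pose proof PI_RGT_0; lra).
replace (sin x) with (2 * sin (x / 2) * cos (x / 2)) in He
  by (rewrite <- sin_2a; f_equal; field).
replace (cos x) with (2 * cos (x / 2) * cos (x / 2) - 1) in He
  by (rewrite <- cos_2a_cos; f_equal; field).
apply Rmult_eq_reg_r with (2 * sin (x / 2) * cos (x / 2) / x).
- unfold Rdiv in *; rewrite He; field; lra.
- apply Rgt_not_eq, Rdiv_lt_0_compat; [nra|lra].
Qed.

Lemma geometric_tail (a : nat -> R) (l C t : R) (n : nat) : 0 <= C -> 0 <= t < 1 ->
  is_series a l -> (forall k, Rabs (a k) <= C * t ^ k) ->
  Rabs (sum_f_R0 a n - l) <= C * t ^ S n / (1 - t).
Proof.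
intros HC Ht Hl Ha; apply is_series_sum_f_R0 in Hl.
assert (H : forall m, Rabs (sum_f_R0 a (m + n) - sum_f_R0 a n)
              <= C * (t ^ S n - t ^ S (m + n)) / (1 - t)).
{ induction m as [|m IH].
  - simpl plus; rewrite !Rminus_diag, Rabs_R0; unfold Rdiv; lra.
  - rewrite Nat.add_succ_l, tech5.
    pose proof (Rabs_triang (sum_f_R0 a (m + n) - sum_f_R0 a n) (a (S (m + n)))) as Htr.
    replace (sum_f_R0 a (m + n) + a (S (m + n)) - sum_f_R0 a n)
      with (sum_f_R0 a (m + n) - sum_f_R0 a n + a (S (m + n))) by ring.
    specialize (Ha (S (m + n))).
    replace (C * (t ^ S n - t ^ S (S (m + n))) / (1 - t)) with
      (C * (t ^ S n - t ^ S (m + n)) / (1 - t) + C * t ^ S (m + n))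
      by (simpl; field; lra).
    lra. }
rewrite Rabs_minus_sym.
apply (is_lim_seq_le (fun m => Rabs (sum_f_R0 a (m + n) - sum_f_R0 a n))
  (fun _ => C * t ^ S n / (1 - t)) (Rabs (l - sum_f_R0 a n)) (C * t ^ S n / (1 - t))).
- intros m; eapply Rle_trans; [apply H|].
  apply Rmult_le_compat_r; [left; apply Rinv_0_lt_compat; lra|].
  apply Rmult_le_compat_l; [assumption|].
  pose proof (pow_le t (S (m + n)) (proj1 Ht)); lra.
- apply (is_lim_seq_abs _ (l - sum_f_R0 a n)).
  apply is_lim_seq_minus'; [|apply is_lim_seq_const].
  now apply is_lim_seq_incr_n.
- apply is_lim_seq_const.
Qed.

(** Coefficient of [x ^ (2 k + 2)] in [ln x - ln (2 sin (x / 2))]; the index is shifted because this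
    expansion has no constant term. *)
Definition log_coef (k : nat) : R :=
  zeta (INR (2 * S k)) / (INR (S k) * (2 * PI) ^ (2 * S k)).

Lemma log_coef_cot (k : nat) : 2 * INR (S k) * log_coef k = - cot_coef (S k).
Proof.
unfold log_coef, cot_coef; pose proof (INR_S_pos k).
set (u := INR (S k)) in *; clearbody u.
generalize (zeta (INR (2 * S k))); intros z.
field; split; [apply pow_nonzero; pose proof PI_RGT_0|]; lra.
Qed.

Definition log_sine_error (M : nat) (x : R) : R :=
  ln (2 * sin (x / 2)) - ln x + sum_f_R0 (fun k => log_coef k * x ^ (2 * S k)) M.

(** The derivative is a tail of the cotangent series divided by [x]. The constant coefficient 1 of
    that series comes from [- ln x], which is why the partial sum extends to [S M]. *)
Lemma is_derive_log_sine_error (M : nat) (x : R) : 0 < x <= PI / 2 ->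
  is_derive (log_sine_error M) x
    ((x * cos (x / 2) / (2 * sin (x / 2))
       - sum_f_R0 (fun k => cot_coef k * x ^ (2 * k)) (S M)) / x).
Proof.
intros Hx; pose proof PI_RGT_0 as HP; pose proof (sin_half_pos x ltac:(lra)) as Hs.
evar_last.
{ apply (is_derive_plus (fun x => ln (2 * sin (x / 2)) - ln x)
    (fun x => sum_f_R0 (fun k => log_coef k * x ^ (2 * S k)) M)).
  - auto_derive; [|reflexivity].
    change (x * / 2) with (x / 2); repeat split; lra.
  - apply (is_derive_sum_f_R0 (fun k x => log_coef k * x ^ (2 * S k))
      (fun k x => - cot_coef (S k) * x ^ S (2 * k))).
    intros k; rewrite <- log_coef_cot; generalize (log_coef k); intros c.
    replace (2 * INR (S k)) with (INR (S (S (2 * k))))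
      by (rewrite <- mult_INR with (n := 2%nat); f_equal; lia).
    replace (2 * S k)%nat with (S (S (2 * k))) by lia.
    evar_last.
    { apply (is_derive_scal (fun x => x ^ S (S (2 * k)))), is_derive_pow, is_derive_id. }
    unfold one; cbn -[INR pow Nat.mul]; ring. }
rewrite sum_f_R0_S, Nat.mul_0_r, pow_O, Rmult_1_r; change (cot_coef 0) with 1.
match goal with |- plus ?a ?b = ?c => change (a + b = c :> R) end.
replace (sum_f_R0 (fun k => cot_coef (S k) * _) M)
  with (- x * sum_f_R0 (fun k => - cot_coef (S k) * x ^ S (2 * k)) M).
- change (x * / 2) with (x / 2); field; split; lra.
- rewrite scal_sum; apply sum_eq; intros k _.
  replace (2 * S k)%nat with (S (S (2 * k))) by lia.
  rewrite <- (tech_pow_Rmult x (S (2 * k))); ring.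
Qed.

Lemma ln_sinc_vanishes : vanishes_at_0 (fun x => ln (2 * sin (x / 2)) - ln x).
Proof.
pose proof PI_RGT_0 as HP.
assert (Hl : is_lim (fun y => ln (sin y / y)) 0 (ln 1)).
{ apply is_lim_comp_continuous; [apply is_lim_sinc_0|].
  apply (ex_derive_continuous (V := R_NormedModule)); auto_derive; lra. }
rewrite ln_1 in Hl; apply is_lim_spec in Hl.
intros eps He; destruct (Hl (mkposreal eps He)) as [d Hd]; simpl in Hd.
exists (Rmin d PI); split; [apply Rmin_pos; [apply cond_pos|assumption]|].
intros x Hx; pose proof (Rmin_l d PI); pose proof (Rmin_r d PI).
pose proof (sin_half_pos x ltac:(lra)) as Hs.
replace (ln (2 * sin (x / 2)) - ln x) with (ln (sin (x / 2) / (x / 2)) - 0).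
- left; apply Hd; [|lra].
  unfold ball; simpl; unfold AbsRing_ball, abs, minus, plus, opp; simpl.
  rewrite Rabs_pos_eq; lra.
- rewrite Rminus_0_r, <- ln_div by lra; f_equal; field; lra.
Qed.

Lemma log_sine_error_vanishes (M : nat) : vanishes_at_0 (log_sine_error M).
Proof.
assert (Hs : vanishes_at_0 (fun x => - sum_f_R0 (fun k => log_coef k * x ^ (2 * S k)) M)).
{ apply vanishes_at_0_continuous.
  - rewrite sum_eq_R0; [apply Ropp_0|]; intros k _; rewrite pow_ne_zero by lia; ring.
  - apply (ex_derive_opp (V := R_NormedModule)); eexists.
    apply (is_derive_sum_f_R0 (fun k x => log_coef k * x ^ (2 * S k))
      (fun k x => log_coef k * (INR (2 * S k) * 1 * x ^ Init.Nat.pred (2 * S k)))).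
    intros k; apply (is_derive_scal (fun x => x ^ (2 * S k))).
    apply is_derive_pow, (is_derive_id (K := R_AbsRing)). }
pose proof (vanishes_at_0_minus _ _ ln_sinc_vanishes Hs) as H.
intros eps He; destruct (H eps He) as [d [Hd Hv]]; exists d; split; [assumption|].
intros x Hx; specialize (Hv x Hx); unfold log_sine_error.
unfold Rminus at 1 in Hv; now rewrite Ropp_involutive in Hv.
Qed.

Lemma log_sine_error_bound (M : nat) (x : R) : 0 < x <= PI / 2 ->
  Rabs (log_sine_error M x) <= 5 * (/ 16) ^ S M * x.
Proof.
pose proof PI_RGT_0 as HP.
apply (vanishes_mvt_bound (log_sine_error M) _ (PI / 2) _ (is_derive_log_sine_error M));
  [|apply log_sine_error_vanishes].
clear x; intros x Hx; pose proof (ratio_bound x Hx) as Ht.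
assert (Ht1 : 0 <= (x / (2 * PI)) ^ 2 < 1) by lra.
pose proof (geometric_tail _ _ 4 _ (S M) ltac:(lra) Ht1 (is_series_cot x Hx)
  (fun k => cot_term_bound k x)) as Hb.
rewrite Rabs_minus_sym in Hb.
unfold Rdiv at 1; rewrite Rabs_mult, (Rabs_pos_eq (/ x)) by (left; apply Rinv_0_lt_compat; lra).
apply Rle_div_l; [lra|].
set (t := (x / (2 * PI)) ^ 2) in *.
eapply Rle_trans; [exact Hb|]; apply Rle_div_l; [lra|].
(* The tail is at most [4 t ^ (M + 2) / (1 - t)]. One factor [t] pays for the division by [x], the
   others are bounded by 1/16, and [4 * 16 / 15 < 5]. *)
assert (Htx : t <= x).
{ assert (HPI : 3 < PI) by (pose proof PI2_3_2; lra).
  unfold t; assert (x / (2 * PI) <= x).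
  { apply Rle_div_l; nra. }
  assert (0 <= x / (2 * PI) <= 1); [|nra].
  split; [left; apply Rdiv_lt_0_compat; lra|apply Rle_div_l; lra]. }
assert (Htp : t ^ S M <= (/ 16) ^ S M) by (apply pow_incr; lra).
pose proof (pow_le t (S M) (proj1 Ht)).
rewrite <- (tech_pow_Rmult _ (S M)).
set (p := t ^ S M) in *; set (r := (/ 16) ^ S M) in *; clearbody p r t.
assert (p * t <= r * x) by (apply Rmult_le_compat; lra).
assert (0 <= r * x) by nra.
nra.
Qed.

Lemma log_coef_nonneg (k : nat) : 0 <= log_coef k.
Proof.
unfold log_coef; left; apply Rdiv_lt_0_compat; [apply zeta_bounds; lia|].
apply Rmult_lt_0_compat; [apply INR_S_pos|apply pow_lt; pose proof PI_RGT_0; lra].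
Qed.

Lemma log_coef_sum_bound (M : nat) (x : R) : 0 < x <= PI / 2 ->
  sum_f_R0 (fun k => log_coef k * x ^ (2 * S k)) M <= 5.
Proof.
intros Hx; pose proof (ratio_bound x Hx) as Ht.
apply Rle_trans with (sum_f_R0 (fun k => 4 * (/ 16) ^ k) M).
- apply sum_Rle; intros k _.
  apply Rle_trans with (Rabs (cot_coef (S k) * x ^ (2 * S k))).
  + rewrite <- (Rabs_Ropp (_ * _)), Ropp_mult_distr_l, <- log_coef_cot.
    pose proof (log_coef_nonneg k); pose proof (pow_le x (2 * S k) ltac:(lra)).
    pose proof (pos_INR k); rewrite S_INR.
    assert (0 <= log_coef k * x ^ (2 * S k)) by now apply Rmult_le_pos.
    eapply Rle_trans; [|apply Rle_abs]; nra.
  + eapply Rle_trans; [apply cot_term_bound|].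
    apply Rmult_le_compat_l; [lra|].
    apply Rle_trans with ((/ 16) ^ S k); [apply pow_incr; lra|].
    simpl; pose proof (pow_lt (/ 16) k ltac:(lra)); lra.
(* The subtracted power makes the bound inductive: it is an equality at [M = 0]. *)
- assert (H : sum_f_R0 (fun k => 4 * (/ 16) ^ k) M <= 5 - (/ 16) ^ M).
  { induction M as [|M IH]; [simpl; lra|].
    rewrite tech5; simpl pow; pose proof (pow_lt (/ 16) M ltac:(lra)); lra. }
  pose proof (pow_lt (/ 16) M ltac:(lra)); lra.
Qed.

(** * The cosine sum *)

Lemma derive_nonneg_le (f df : R -> R) (a b : R) : a <= b ->
  (forall x, a <= x <= b -> is_derive f x (df x)) ->
  (forall x, a <= x <= b -> 0 <= df x) -> f a <= f b.
Proof.
intros Hab Hd HB.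
destruct (MVT_gen f a b df) as [c [Hc He]];
  rewrite ?Rmin_left, ?Rmax_right in * by lra.
- intros x Hx; apply Hd; lra.
- intros x Hx; apply derivable_continuous_pt; exists (df x).
  apply is_derive_Reals, Hd; lra.
- specialize (HB c Hc); nra.
Qed.

Lemma alternating_geometric_sum (N : nat) (x : R) : 1 + x <> 0 ->
  / (1 + x) + sum_f_R0 (fun n => (-1) ^ S n * x ^ n) N = (- x) ^ S N / (1 + x).
Proof.
intros Hx; replace (- x) with (-1 * x) by ring.
induction N as [|N IH]; [simpl; field; assumption|].
rewrite tech5, <- Rplus_assoc, IH, !Rpow_mult_distr.
simpl; field; assumption.
Qed.

(** The derivative of the Taylor remainder of [ln (1 + x)] is at most [x ^ (N + 1)] in absolute
    value. A constant bound on it would give no decay, so the remainder [h] is compared with the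
    primitive [g] of [x ^ (N + 1)] through the monotonicity of [g + h] and [g - h]. *)
Lemma alternating_harmonic_bound (N : nat) :
  Rabs (ln 2 + sum_f_R0 (fun n => (-1) ^ S n / INR (S n)) N) <= / INR (S (S N)).
Proof.
set (h := fun x => ln (1 + x) + sum_f_R0 (fun n => (-1) ^ S n * (x ^ S n / INR (S n))) N).
set (g := fun x => x ^ S (S N) / INR (S (S N))).
assert (Hpow : forall n x, is_derive (fun x => x ^ S n / INR (S n)) x (x ^ n)).
{ intros n x; pose proof (INR_S_pos n).
  evar_last.
  - apply (is_derive_ext (fun x => / INR (S n) * x ^ S n)); [intros; apply Rmult_comm|].
    apply (is_derive_scal (fun x => x ^ S n)), is_derive_pow, (is_derive_id (K := R_AbsRing)).
  - unfold one; cbn -[INR pow]; field; lra. }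
assert (Hh : forall x, 0 <= x <= 1 -> is_derive h x ((- x) ^ S N / (1 + x))).
{ intros x Hx; rewrite <- alternating_geometric_sum by lra.
  apply (is_derive_plus (fun x => ln (1 + x))).
  - auto_derive; [lra|field; lra].
  - apply (is_derive_sum_f_R0 (fun n x => (-1) ^ S n * (x ^ S n / INR (S n)))
      (fun n x => (-1) ^ S n * x ^ n)).
    intros n; apply (is_derive_scal (fun x => x ^ S n / INR (S n))), Hpow. }
assert (Hb : forall x, 0 <= x <= 1 -> Rabs ((- x) ^ S N / (1 + x)) <= x ^ S N).
{ intros x Hx; unfold Rdiv; rewrite Rabs_mult, <- RPow_abs, Rabs_Ropp.
  rewrite (Rabs_pos_eq x) by lra.
  rewrite Rabs_pos_eq by (left; apply Rinv_0_lt_compat; lra).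
  pose proof (pow_le x (S N) (proj1 Hx)).
  assert (/ (1 + x) <= 1) by (rewrite <- Rinv_1; apply Rinv_le_contravar; lra).
  nra. }
assert (H0 : h 0 = 0).
{ unfold h; rewrite Rplus_0_r, ln_1, Rplus_0_l; apply sum_eq_R0; intros n _.
  rewrite pow_ne_zero by lia; unfold Rdiv; ring. }
assert (Hg0 : g 0 = 0) by (unfold g; rewrite pow_ne_zero by lia; unfold Rdiv; ring).
assert (Hg1 : g 1 = / INR (S (S N))) by (unfold g; rewrite pow1; unfold Rdiv; ring).
replace (ln 2 + _) with (h 1).
2:{ unfold h; f_equal; apply sum_eq; intros n _.
    rewrite pow1; unfold Rdiv; ring. }
rewrite <- Hg1; apply Rabs_le; split.
- enough (h 0 + g 0 <= h 1 + g 1) by lra.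
  apply (derive_nonneg_le (fun x => h x + g x) (fun x => (- x) ^ S N / (1 + x) + x ^ S N));
    [lra| |]; intros x Hx.
  + apply (is_derive_plus h g); [now apply Hh|apply Hpow].
  + specialize (Hb x Hx); apply Rabs_le_between in Hb; lra.
- enough (g 0 - h 0 <= g 1 - h 1) by lra.
  apply (derive_nonneg_le (fun x => g x - h x) (fun x => x ^ S N - (- x) ^ S N / (1 + x)));
    [lra| |]; intros x Hx.
  + apply (is_derive_minus g h); [apply Hpow|now apply Hh].
  + specialize (Hb x Hx); apply Rabs_le_between in Hb; lra.
Qed.

Lemma cosine_sum_unif (d eps : R) : 0 < d <= PI -> 0 < eps ->
  exists N0, forall N x, (N0 <= N)%nat -> d <= x <= PI ->
    Rabs (phi_sum 0 N 0 x + ln (2 * sin (x / 2))) <= eps.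
Proof.
apply (oscillatory_lim cos sin (fun N x => phi_sum 0 N 0 x + ln (2 * sin (x / 2)))).
- intros y; apply is_derive_sin.
- intros y; apply Rabs_le, SIN_bound.
- intros N x Hx; pose proof (sin_half_pos x Hx) as Hs.
  pose proof (two_sin_sum_sin N x) as H2.
  replace (cos ((INR N + 3 / 2) * x)) with
    (cos (x / 2) - 2 * sin (x / 2) * sum_f_R0 (fun n => sin (INR (S n) * x)) N)
    by (rewrite H2; ring).
  replace (_ / _) with (- sum_f_R0 (fun n => sin (INR (S n) * x)) N
    + cos (x / 2) / (2 * sin (x / 2))) by (field; lra).
  apply (is_derive_plus (phi_sum 0 N 0)).
  + rewrite <- (Rmult_1_l (sum_f_R0 _ _)), Ropp_mult_distr_l, scal_sum.
    apply (is_derive_sum_f_R0 (fun n x => phi 0 (INR (S n) * x) / INR (S n) ^ 1)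
      (fun n x => sin (INR (S n) * x) * - (1))).
    intros n; pose proof (INR_S_pos n); cbn [phi].
    set (c := INR (S n)) in *; clearbody c; auto_derive; [exact I|simpl; field; lra].
  + auto_derive; change (x * / 2) with (x / 2); [lra|field; lra].
(* At [PI] the limit function is [- ln 2] and the cosine sum is the alternating harmonic sum. *)
- apply lim_seq_eps; intros eps' He.
  destruct (nfloor_ex (/ eps')) as [N0 HN0]; [left; now apply Rinv_0_lt_compat|].
  exists N0; intros N HN; rewrite Rminus_0_r, sin_PI2, Rmult_1_r, Rplus_comm.
  unfold phi_sum.
  rewrite (sum_eq _ (fun n => (-1) ^ S n / INR (S n))).
  + eapply Rle_trans; [apply alternating_harmonic_bound|].
    rewrite <- (Rinv_inv eps'); apply Rinv_le_contravar; [now apply Rinv_0_lt_compat|].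
    assert (INR N0 <= INR N) by (apply le_INR; lia).
    rewrite !S_INR; lra.
  + intros n _; cbn [phi Nat.add]; rewrite cos_INR_PI, pow_1; reflexivity.
Qed.

(* The [m]-fold iterated primitive from 0 of [- ln x + sum_k log_coef k * x ^ (2 k + 2)]. *)
Definition log_primitive (M m : nat) (x : R) : R :=
  x ^ m / INR (fact m) * (harmonic m - ln x)
  + sum_f_R0 (fun k => log_coef k * (INR (fact (2 * S k)) *
      (x ^ (2 * S k + m) / INR (fact (2 * S k + m))))) M.

Lemma harmonic_S (m : nat) : harmonic (S m) = harmonic m + / INR (S m).
Proof. unfold harmonic; now rewrite sum_n_Sm by lia. Qed.

Lemma harmonic_0 : harmonic 0 = 0.
Proof. unfold harmonic; now rewrite sum_n_m_zero by lia. Qed.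

Lemma harmonic_nonneg (m : nat) : 0 <= harmonic m.
Proof.
induction m as [|m IH]; [rewrite harmonic_0; lra|].
rewrite harmonic_S; pose proof (Rinv_0_lt_compat _ (INR_S_pos m)); lra.
Qed.

(** The origin of the harmonic numbers: differentiating the logarithm produces
    [- x ^ m / (m! (m + 1))], which the increment [1 / (m + 1)] of [harmonic] compensates
    exactly. *)
Lemma is_derive_log_primitive (M m : nat) (x : R) : 0 < x ->
  is_derive (log_primitive M (S m)) x (log_primitive M m x).
Proof.
intros Hx; unfold log_primitive.
apply (is_derive_plus (fun x => x ^ S m / INR (fact (S m)) * (harmonic (S m) - ln x))
  (fun x => sum_f_R0 (fun k => log_coef k * (INR (fact (2 * S k)) *
      (x ^ (2 * S k + S m) / INR (fact (2 * S k + S m))))) M)).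
- evar_last.
  { apply (is_derive_mult (fun x => x ^ S m / INR (fact (S m)))
      (fun x => harmonic (S m) - ln x) x).
    - apply is_derive_monomial.
    - auto_derive; [assumption|reflexivity].
    - intros; apply Rmult_comm. }
  unfold plus, mult; cbn -[INR pow fact harmonic].
  rewrite harmonic_S, fact_simpl, mult_INR, <- tech_pow_Rmult.
  pose proof (INR_S_pos m); pose proof (INR_fact_neq_0 m).
  set (u := INR (S m)) in *; clearbody u; field; repeat split; try assumption; lra.
- apply (is_derive_sum_f_R0 (fun k x => log_coef k * (INR (fact (2 * S k)) *
      (x ^ (2 * S k + S m) / INR (fact (2 * S k + S m)))))
    (fun k x => log_coef k * (INR (fact (2 * S k)) *
      (x ^ (2 * S k + m) / INR (fact (2 * S k + m)))))).
  intros k; apply (is_derive_scal (fun x => INR (fact (2 * S k)) *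
      (x ^ (2 * S k + S m) / INR (fact (2 * S k + S m))))).
  apply (is_derive_scal (fun x => x ^ (2 * S k + S m) / INR (fact (2 * S k + S m)))).
  rewrite Nat.add_succ_r; apply is_derive_monomial.
Qed.

(** Write [- ln x = 2 ln (1 / sqrt x)] and use [1 + ln u <= u]. *)
Lemma neg_ln_le_sqrt (x : R) : 0 < x <= 1 -> 0 <= - ln x <= 2 / sqrt x.
Proof.
intros Hx; pose proof (sqrt_lt_R0 x (proj1 Hx)) as Hs.
split; [pose proof (ln_le x 1 (proj1 Hx) (proj2 Hx)) as H; rewrite ln_1 in H; lra|].
assert (Hl : ln x = - (2 * ln (/ sqrt x))).
{ rewrite ln_Rinv by assumption.
  rewrite <- (sqrt_sqrt x) at 1 by lra; rewrite ln_mult by assumption; ring. }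
pose proof (Rinv_0_lt_compat _ Hs) as Hi.
pose proof (exp_ineq1_le (ln (/ sqrt x))) as He; rewrite exp_ln in He by assumption.
unfold Rdiv; lra.
Qed.

(** Uniform in [M] and of the same order as the bound on [phi_sum]. The constant 7 is 2, from
    [x * (2 / sqrt x)], plus 5, from the power series. *)
Lemma log_primitive_bound (M m : nat) (x : R) : 0 < x <= 1 ->
  Rabs (log_primitive M (S m) x) <= (harmonic (S m) + 7) * sqrt x.
Proof.
intros Hx; pose proof (sqrt_lt_R0 x (proj1 Hx)) as Hs.
pose proof (sqrt_sqrt x (Rlt_le _ _ (proj1 Hx))) as Hss.
assert (Hs1 : sqrt x <= 1) by (rewrite <- sqrt_1; apply sqrt_le_1_alt; lra).
pose proof (neg_ln_le_sqrt x Hx) as Hl.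
pose proof (harmonic_nonneg (S m)) as Hh.
assert (Hm : 0 <= x ^ m <= 1).
{ split; [apply pow_le; lra|]; rewrite <- (pow1 m); apply pow_incr; lra. }
assert (Hf : 0 < / INR (fact (S m)) <= 1).
{ split; [apply Rinv_0_lt_compat, INR_fact_lt_0|].
  rewrite <- Rinv_1; apply Rinv_le_contravar; [lra|].
  apply (le_INR 1), lt_O_fact. }
assert (Hmon : 0 <= x ^ S m / INR (fact (S m)) <= x).
{ unfold Rdiv; simpl pow; split; [apply Rmult_le_pos; nra|].
  assert (x * x ^ m <= x) by nra.
  assert (0 <= x * x ^ m) by nra. nra. }
unfold log_primitive.
eapply Rle_trans; [apply Rabs_triang|].
apply Rle_trans with ((harmonic (S m) + 2) * sqrt x + 5 * sqrt x); [|lra].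
apply Rplus_le_compat.
- rewrite Rabs_mult, !Rabs_pos_eq by lra.
  apply Rle_trans with (x * (harmonic (S m) + 2 / sqrt x)).
  + apply Rmult_le_compat; lra.
  + rewrite Rmult_plus_distr_l, Rmult_plus_distr_r.
    replace (x * (2 / sqrt x)) with (2 * sqrt x) by (rewrite <- Hss at 2; field; lra).
    assert (x <= sqrt x) by nra.
    assert (x * harmonic (S m) <= harmonic (S m) * sqrt x) by nra. lra.
- apply Rle_trans with (x * sum_f_R0 (fun k => log_coef k * x ^ (2 * S k)) M).
  + eapply Rle_trans; [apply Rsum_abs|]; rewrite scal_sum; apply sum_Rle; intros k _.
    pose proof (log_coef_nonneg k) as Hc.
    pose proof (INR_fact_lt_0 (2 * S k)) as Hf1.
    pose proof (INR_fact_lt_0 (2 * S k + S m)) as Hf2.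
    pose proof (pow_lt x (2 * S k + S m) (proj1 Hx)) as Hp.
    pose proof (Rinv_0_lt_compat _ Hf2) as Hi.
    rewrite Rabs_pos_eq.
    2:{ apply Rmult_le_pos; [lra|]; apply Rmult_le_pos; [lra|]; apply Rmult_le_pos; lra. }
    rewrite Rmult_assoc; apply Rmult_le_compat_l; [assumption|].
    apply Rle_trans with (x ^ (2 * S k + S m)).
    * replace (INR (fact (2 * S k)) * (x ^ (2 * S k + S m) / INR (fact (2 * S k + S m))))
        with (INR (fact (2 * S k)) * x ^ (2 * S k + S m) / INR (fact (2 * S k + S m)))
        by (field; lra).
      apply Rle_div_l; [assumption|]; rewrite Rmult_comm.
      apply Rmult_le_compat_l; [lra|].
      apply le_INR, fact_le; lia.
    * rewrite pow_add; apply Rmult_le_compat_l; [apply pow_le; lra|].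
      simpl pow; nra.
  + pose proof (log_coef_sum_bound M x ltac:(pose proof PI2_3_2; lra)).
    assert (0 <= sum_f_R0 (fun k => log_coef k * x ^ (2 * S k)) M).
    { apply cond_pos_sum; intros k; apply Rmult_le_pos;
        [apply log_coef_nonneg|apply pow_le; lra]. }
    nra.
Qed.

Lemma log_primitive_vanishes (M m : nat) : vanishes_at_0 (log_primitive M (S m)).
Proof.
intros eps He; pose proof (harmonic_nonneg (S m)).
destruct (sqrt_equi_small (harmonic (S m) + 7) ltac:(lra) eps He) as [d [Hd H1]].
exists (Rmin d 1); split; [apply Rmin_pos; lra|]; intros x Hx.
pose proof (Rmin_l d 1); pose proof (Rmin_r d 1).
eapply Rle_trans; [apply log_primitive_bound; lra|apply H1; lra].
Qed.

(** One index [N] serves as length of the cosine sum and as truncation of the logarithmic series, so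
    that a single sequence of errors is integrated. At level 0 the error splits at
    [- ln (2 sin (x / 2))]: the first part is small away from 0, the second geometrically small. *)
Lemma cosine_sum_lim (m : nat) :
  is_lim_seq (fun N => phi_sum 0 N (S m) (PI / 2) - log_primitive N (S m) (PI / 2)) 0.
Proof.
pose proof PI_RGT_0 as HP.
assert (Hd : forall N m x, 0 < x <= PI / 2 ->
  is_derive (fun x => phi_sum 0 N (S m) x - log_primitive N (S m) x) x
    (phi_sum 0 N m x - log_primitive N m x)).
{ intros N k x Hx; apply (is_derive_minus (phi_sum 0 N (S k)) (log_primitive N (S k))).
  - apply is_derive_phi_sum.
  - apply is_derive_log_primitive; lra. }
apply (iterated_primitive_lim (fun N m x => phi_sum 0 N m x - log_primitive N m x)
  (PI / 2)); try lra; [exact Hd| |].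
- intros N k; apply vanishes_at_0_minus; [apply phi_sum_vanishes|apply log_primitive_vanishes].
- apply (primitive_unif_small (fun N m x => phi_sum 0 N m x - log_primitive N m x)
    (PI / 2) ltac:(lra) Hd).
  + intros eps He; pose proof (harmonic_nonneg 1).
    destruct (sqrt_equi_small (6 + (harmonic 1 + 7)) ltac:(lra) eps He) as [d [Hd0 H1]].
    exists (Rmin d 1); split; [apply Rmin_pos; lra|]; intros N x Hx.
    pose proof (Rmin_l d 1); pose proof (Rmin_r d 1).
    pose proof (phi_sum_1_le 0 N x ltac:(lia) ltac:(lra)).
    pose proof (log_primitive_bound N 0 x ltac:(lra)).
    pose proof (Rabs_triang (phi_sum 0 N 1 x) (- log_primitive N 1 x)) as Ht.
    rewrite Rabs_Ropp in Ht; specialize (H1 x ltac:(lra)); unfold Rminus; lra.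
  + intros d eps Hd0 He.
    destruct (cosine_sum_unif d (eps / 2) ltac:(lra) ltac:(lra)) as [N1 H1].
    assert (Hg : is_lim_seq (fun M => (/ 16) ^ M) 0)
      by (apply is_lim_seq_geom; rewrite Rabs_pos_eq; lra).
    destruct (proj1 (lim_seq_eps _ _) Hg (eps / 2)) as [N2 H2]; [lra|].
    exists (N1 + N2)%nat; intros N x HN Hx.
    specialize (H1 N x ltac:(lia) ltac:(lra)).
    specialize (H2 N ltac:(lia)); rewrite Rminus_0_r, Rabs_pos_eq in H2
      by (apply pow_le; lra).
    pose proof (log_sine_error_bound N x ltac:(lra)) as H3.
    replace (phi_sum 0 N 0 x - log_primitive N 0 x) with
      (phi_sum 0 N 0 x + ln (2 * sin (x / 2)) + - log_sine_error N x).
    * eapply Rle_trans; [apply Rabs_triang|]; rewrite Rabs_Ropp.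
      (* From [x <= PI / 2 <= 2], so that [5 * x / 16 < 1]. *)
      assert (5 * (/ 16) ^ S N * x <= (/ 16) ^ N); [|lra].
      simpl pow; pose proof (pow_le (/ 16) N ltac:(lra)); pose proof PI_4; nra.
    * unfold log_primitive, log_sine_error; rewrite harmonic_0.
      rewrite (sum_eq (fun k => log_coef k * (_ * _)) (fun k => log_coef k * x ^ (2 * S k))).
      -- simpl; field.
      -- intros k _; rewrite Nat.add_0_r; field; apply INR_fact_neq_0.
Qed.

(** * Evaluation at [PI / 2] *)

Lemma phi_even (t : nat) (y : R) :
  phi (2 * S t) y = (-1) ^ S t * cos y
    + sum_f_R0 (fun k => (-1) ^ (t - k) * (y ^ (2 * k) / INR (fact (2 * k)))) t.
Proof.
induction t as [|t IH]; [simpl; field|].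
replace (2 * S (S t))%nat with (S (S (2 * S t))) by lia.
rewrite phi_SS, IH, tech5, Nat.sub_diag.
rewrite (sum_eq (fun k => (-1) ^ (S t - k) * _)
  (fun k => (-1) ^ (t - k) * (y ^ (2 * k) / INR (fact (2 * k))) * -1)).
- rewrite <- scal_sum, <- (tech_pow_Rmult (-1) (S t)), pow_O; ring.
- intros k Hk; rewrite Nat.sub_succ_l, <- tech_pow_Rmult by lia; ring.
Qed.

Definition quarter_sum (s N : nat) : R :=
  sum_f_R0 (fun n => cos (INR (S n) * (PI / 2)) / INR (S n) ^ s) N.

Lemma sum_f_R0_4 (f : nat -> R) (K : nat) :
  sum_f_R0 f (4 * S K + 3) = sum_f_R0 f (4 * K + 3)
    + (f (4 * S K)%nat + f (4 * S K + 1)%nat + f (4 * S K + 2)%nat + f (4 * S K + 3)%nat).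
Proof.
replace (4 * S K + 3)%nat with (S (S (S (S (4 * K + 3))))) by lia.
rewrite !tech5.
replace (4 * S K)%nat with (S (4 * K + 3)) by lia.
replace (S (4 * K + 3) + 1)%nat with (S (S (4 * K + 3))) by lia.
replace (S (4 * K + 3) + 2)%nat with (S (S (S (4 * K + 3)))) by lia.
ring.
Qed.

Lemma cos_half_even (j : nat) : cos (INR (2 * j) * (PI / 2)) = (-1) ^ j.
Proof. rewrite <- cos_INR_PI, mult_INR; f_equal; simpl; field. Qed.

Lemma cos_half_odd (j : nat) : cos (INR (S (2 * j)) * (PI / 2)) = 0.
Proof.
replace (INR (S (2 * j)) * (PI / 2)) with (INR j * PI + PI / 2)
  by (rewrite S_INR, mult_INR; simpl; field).
rewrite cos_plus, cos_PI2, sin_PI2, sin_INR_PI; ring.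
Qed.

(** Within a period of four the odd multiples of [PI / 2] contribute 0 and the even ones alternate
    in sign. The alternating pair is written as twice its positive term minus the sum of both
    moduli, so that complete zeta sums appear. *)
Lemma quarter_block (s K : nat) :
  let f n := cos (INR (S n) * (PI / 2)) / INR (S n) ^ s in
  f (4 * K)%nat + f (4 * K + 1)%nat + f (4 * K + 2)%nat + f (4 * K + 3)%nat
  = 2 / 4 ^ s * / INR (S K) ^ s
    - / 2 ^ s * (/ INR (S (2 * K)) ^ s + / INR (S (S (2 * K))) ^ s).
Proof.
intros f; unfold f.
replace (S (4 * K)) with (S (2 * (2 * K))) by lia; rewrite cos_half_odd.
replace (S (4 * K + 2)) with (S (2 * (2 * K + 1))) by lia; rewrite cos_half_odd.
replace (S (4 * K + 1)) with (2 * S (2 * K))%nat by lia; rewrite cos_half_even.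
replace (S (4 * K + 3)) with (2 * (2 * S K))%nat by lia; rewrite cos_half_even.
replace (S (S (2 * K))) with (2 * S K)%nat by lia.
rewrite <- tech_pow_Rmult, !pow_mult, !mult_INR, !Rpow_mult_distr.
replace ((-1) ^ 2) with 1 by ring; rewrite !pow1.
replace (4 ^ s) with (2 ^ s * 2 ^ s) by (rewrite <- Rpow_mult_distr; f_equal; ring).
change (INR 2) with 2.
assert (H1 : INR (S (2 * K)) ^ s <> 0)
  by (apply pow_nonzero; pose proof (INR_S_pos (2 * K)); lra).
assert (H2 : INR (S (2 * (2 * K))) ^ s <> 0)
  by (apply pow_nonzero; pose proof (INR_S_pos (2 * (2 * K))); lra).
assert (H3 : INR (S (2 * (2 * K + 1))) ^ s <> 0)
  by (apply pow_nonzero; pose proof (INR_S_pos (2 * (2 * K + 1))); lra).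
assert (H4 : INR (S K) ^ s <> 0) by (apply pow_nonzero; pose proof (INR_S_pos K); lra).
assert (H5 : 2 ^ s <> 0) by (apply pow_nonzero; lra).
generalize dependent (INR (S (2 * K)) ^ s); generalize dependent (INR (S K) ^ s).
generalize dependent (INR (S (2 * (2 * K))) ^ s).
generalize dependent (INR (S (2 * (2 * K + 1))) ^ s).
generalize dependent (2 ^ s); intros.
field; repeat split; assumption.
Qed.

Lemma quarter_sum_zeta_sum (s K : nat) :
  quarter_sum s (4 * K + 3)
  = 2 / 4 ^ s * zeta_sum s K - / 2 ^ s * zeta_sum s (S (2 * K)).
Proof.
pose proof (quarter_block s) as Hb; cbv zeta in Hb.
unfold quarter_sum, zeta_sum; induction K as [|K IH].
- specialize (Hb 0%nat); rewrite tech5; exact Hb.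
- rewrite sum_f_R0_4, IH, Hb, tech5.
  replace (S (2 * S K)) with (S (S (S (2 * K)))) by lia.
  rewrite !tech5.
  replace (2 * S K)%nat with (S (S (2 * K))) by lia; ring.
Qed.

Lemma phi_sum_half_PI (t N : nat) :
  phi_sum 0 N (2 * S t) (PI / 2)
  = (-1) ^ S t * quarter_sum (2 * S t + 1) N
    + sum_f_R0 (fun k => (-1) ^ (t - k) * ((PI / 2) ^ (2 * k) / INR (fact (2 * k)))
        * zeta_sum (2 * S t + 1 - 2 * k) N) t.
Proof.
unfold phi_sum, quarter_sum, zeta_sum; rewrite Nat.add_0_r.
rewrite (sum_eq _ (fun n => cos (INR (S n) * (PI / 2)) / INR (S n) ^ (2 * S t + 1) * (-1) ^ S t
  + sum_f_R0 (fun k => (-1) ^ (t - k) * ((PI / 2) ^ (2 * k) / INR (fact (2 * k)))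
      * / INR (S n) ^ (2 * S t + 1 - 2 * k)) t)).
- rewrite sum_plus; f_equal; [now rewrite <- scal_sum|].
  rewrite sum_f_R0_comm; apply sum_eq; intros k _.
  rewrite scal_sum; apply sum_eq; intros; ring.
- intros n _; rewrite phi_even; unfold Rdiv at 1; rewrite Rmult_plus_distr_r.
  pose proof (INR_S_pos n) as Hn; set (c := INR (S n)) in *; clearbody c.
  f_equal; [unfold Rdiv; ring|].
  rewrite Rmult_comm, scal_sum; apply sum_eq; intros k Hk.
  rewrite Rpow_mult_distr.
  replace (c ^ (2 * S t + 1)) with (c ^ (2 * k) * c ^ (2 * S t + 1 - 2 * k))
    by (rewrite <- pow_add; f_equal; lia).
  field; repeat split; try apply pow_nonzero; try apply INR_fact_neq_0; lra.
Qed.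

Definition even_zeta_term (r n : nat) : R :=
  INR (fact (2 * S n)) / (4 ^ (2 * S n) * INR (fact (2 * r + 2 * S n)) * INR (S n))
    * zeta (INR (2 * S n)).

Lemma ex_series_even_zeta_term (r : nat) : ex_series (even_zeta_term r).
Proof.
apply (ex_series_le (V := R_CompleteNormedModule) _ (fun n => 2 * (/ 16) ^ n)).
2:{ apply (ex_series_scal_l (V := R_NormedModule)), ex_series_geom.
    rewrite Rabs_pos_eq; lra. }
intros n; unfold norm; simpl norm; unfold abs; cbn [AbsRing.abs].
change (Rabs (even_zeta_term r n) <= 2 * (/ 16) ^ n).
unfold even_zeta_term; pose proof (zeta_bounds (2 * S n) ltac:(lia)) as Hz.
pose proof (INR_fact_lt_0 (2 * S n)) as Hf1.
pose proof (INR_fact_lt_0 (2 * r + 2 * S n)) as Hf2.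
assert (Hf : INR (fact (2 * S n)) <= INR (fact (2 * r + 2 * S n)))
  by (apply le_INR, fact_le; lia).
assert (Hn : 1 <= INR (S n)) by (rewrite S_INR; pose proof (pos_INR n); lra).
assert (Hp : 0 < (/ 16) ^ n) by (apply pow_lt; lra).
replace (4 ^ (2 * S n)) with (16 * / (/ 16) ^ n).
2:{ rewrite pow_mult, pow_inv, Rinv_inv; replace (4 ^ 2) with 16 by ring; reflexivity. }
set (q := (/ 16) ^ n) in *; clearbody q.
set (A := INR (fact (2 * S n))) in *; clearbody A.
set (B := INR (fact (2 * r + 2 * S n))) in *; clearbody B.
set (c := INR (S n)) in *; clearbody c.
set (z := zeta _) in *; clearbody z.
assert (HA : 0 <= A / (16 * / q * B * c) <= q).
{ replace (A / (16 * / q * B * c)) with (A * q / (16 * B * c)) by (field; lra).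
  assert (0 < B * c) by nra.
  split; [apply Rdiv_le_0_compat; nra|].
  apply Rle_div_l; [lra|].
  assert (A <= 16 * B * c) by nra. nra. }
rewrite Rabs_pos_eq by (apply Rmult_le_pos; lra); nra.
Qed.

Lemma log_primitive_half_PI (r N : nat) :
  log_primitive N (2 * r) (PI / 2)
  = (PI / 2) ^ (2 * r) * (/ INR (fact (2 * r)) * (harmonic (2 * r) - ln (PI / 2))
      + sum_f_R0 (even_zeta_term r) N).
Proof.
unfold log_primitive; rewrite Rmult_plus_distr_l; f_equal; [unfold Rdiv; ring|].
rewrite scal_sum; apply sum_eq; intros k _; unfold even_zeta_term, log_coef.
rewrite pow_add, (Nat.add_comm (2 * r)).
(* The powers of [PI / 2] cancel and leave the [4 ^ (2 k)] of the final series. *)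
replace (2 * PI) with (4 * (PI / 2)) by field; rewrite Rpow_mult_distr.
pose proof PI_RGT_0 as HP; pose proof (INR_S_pos k).
set (c := INR (S k)) in *; clearbody c.
generalize (zeta (INR (2 * S k))); intros z.
field; repeat split; try apply pow_nonzero; try apply INR_fact_neq_0; lra.
Qed.

Lemma filterlim_nat_mono (f : nat -> nat) : (forall n, (n <= f n)%nat) ->
  filterlim f eventually eventually.
Proof.
intros Hf P [N HN]; exists N; intros n Hn; apply HN; specialize (Hf n); lia.
Qed.

(** Two evaluations of the limit of the iterated cosine sum at [PI / 2]. The zeta side is computed
    along the complete blocks [4 K + 3] only, which suffices since the whole sequence converges to
    the other side. *)
Lemma zeta_odd_relation (t : nat) :
  (-1) ^ S t * ((2 / 4 ^ (2 * S t + 1) - / 2 ^ (2 * S t + 1)) * zeta (INR (2 * S t + 1)))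
  + sum_f_R0 (fun k => (-1) ^ (t - k) * ((PI / 2) ^ (2 * k) / INR (fact (2 * k)))
        * zeta (INR (2 * S t + 1 - 2 * k))) t
  = (PI / 2) ^ (2 * S t) * (/ INR (fact (2 * S t)) * (harmonic (2 * S t) - ln (PI / 2))
      + Series (even_zeta_term (S t))).
Proof.
set (s := (2 * S t + 1)%nat); set (A := _ + sum_f_R0 _ _).
set (B := (PI / 2) ^ (2 * S t) * _).
assert (HA : is_lim_seq (fun K => phi_sum 0 (4 * K + 3) (2 * S t) (PI / 2)) A).
{ apply is_lim_seq_ext with (1 := fun K => eq_sym (phi_sum_half_PI t (4 * K + 3))).
  apply is_lim_seq_plus'.
  - apply is_lim_seq_mult'; [apply is_lim_seq_const|].
    apply is_lim_seq_ext with (1 := fun K => eq_sym (quarter_sum_zeta_sum s K)).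
    rewrite Rmult_minus_distr_r.
    apply is_lim_seq_minus'; apply is_lim_seq_mult'; try apply is_lim_seq_const.
    + apply zeta_sum_lim; unfold s; lia.
    + apply (is_lim_seq_subseq (zeta_sum s) (zeta (INR s)) (fun K => S (2 * K)));
        [apply filterlim_nat_mono; intros; lia|apply zeta_sum_lim; unfold s; lia].
  - apply (is_lim_seq_sum_f_R0 (fun K k => (-1) ^ (t - k) * ((PI / 2) ^ (2 * k) /
      INR (fact (2 * k))) * zeta_sum (s - 2 * k) (4 * K + 3))).
    intros k Hk; apply is_lim_seq_mult'; [apply is_lim_seq_const|].
    apply (is_lim_seq_subseq (zeta_sum (s - 2 * k)) (zeta (INR (s - 2 * k)))
      (fun K => (4 * K + 3)%nat));
      [apply filterlim_nat_mono; intros; lia|apply zeta_sum_lim; unfold s; lia]. }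
assert (HB : is_lim_seq (fun N => log_primitive N (2 * S t) (PI / 2)) B).
{ apply is_lim_seq_ext with (1 := fun N => eq_sym (log_primitive_half_PI (S t) N)).
  apply is_lim_seq_mult'; [apply is_lim_seq_const|].
  apply is_lim_seq_plus'; [apply is_lim_seq_const|].
  apply is_series_sum_f_R0, Series_correct, ex_series_even_zeta_term. }
pose proof (cosine_sum_lim (S (2 * t))) as HD.
replace (S (S (2 * t))) with (2 * S t)%nat in HD by lia.
assert (HC : is_lim_seq (fun N => phi_sum 0 N (2 * S t) (PI / 2)) B).
{ replace B with (0 + B) by ring.
  apply is_lim_seq_ext with (2 := is_lim_seq_plus' _ _ _ _ HD HB).
  intros; ring. }
apply (is_lim_seq_subseq _ _ (fun K => (4 * K + 3)%nat)) in HC.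
2: apply filterlim_nat_mono; intros; lia.
apply is_lim_seq_unique in HA, HC; rewrite HA in HC.
now apply Rbar_finite_eq in HC.
Qed.

Lemma zeta_odd_formula (r : nat) (hr : (1 <= r)%nat) :
  zeta (INR (2 * r + 1)) =
     2 ^ (4 * r + 1) / (2 ^ (4 * r + 1) + 2 ^ (2 * r) - 1)
       * sum_n_m (fun k =>
           (-1) ^ (k - 1) * (1 / INR (fact (2 * k))) * (PI / 2) ^ (2 * k)
             * zeta (INR (2 * r + 1 - 2 * k))) 1 (r - 1)
     + (-1) ^ (r - 1)
       * (2 ^ (2 * r + 1) * PI ^ (2 * r)
          / ((2 ^ (4 * r + 1) + 2 ^ (2 * r) - 1) * INR (fact (2 * r))))
       * (harmonic (2 * r) - ln (PI / 2))
     + (-1) ^ (r - 1)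
       * (2 ^ (2 * r + 1) * PI ^ (2 * r) / (2 ^ (4 * r + 1) + 2 ^ (2 * r) - 1))
       * Series (even_zeta_term r).
Proof.
destruct r as [|t]; [lia|].
pose proof (zeta_odd_relation t) as H.
replace (S t - 1)%nat with t by lia.
set (U := sum_n_m _ 1 t).
(* The term [k = 0] is the second occurrence of [zeta (2 r + 1)]; the others form the sum of the
   statement, empty for [r = 1]. *)
replace (sum_f_R0 _ t) with ((-1) ^ t * (zeta (INR (2 * S t + 1)) - U)) in H.
2:{ rewrite <- sum_n_Reals; unfold sum_n; rewrite sum_Sn_m by lia.
    rewrite Nat.sub_0_r, Nat.mul_0_r, Nat.sub_0_r, Rmult_minus_distr_l.
    match goal with |- ?l = plus ?a ?b => change (l = a + b) end.
    unfold Rminus; f_equal; [simpl; field|].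
    unfold U; change (sum_n_m ?f 1 t) with (sum_n_m f 1 t : R).
    rewrite Ropp_mult_distr_l.
    change (- (-1) ^ t * ?u) with (mult (- (-1) ^ t) u).
    rewrite <- (sum_n_m_mult_l (K := R_Ring)).
    apply sum_n_m_ext_loc; intros k Hk.
    match goal with |- mult ?a ?b = ?u => change (a * b = u :> R) end.
    destruct k as [|k]; [lia|].
    replace (S k - 1)%nat with k by lia.
    rewrite <- (pow_m1_sub t (S k)) by lia; rewrite <- tech_pow_Rmult.
    transitivity ((-1) ^ k * (-1) ^ k * ((-1) ^ (t - S k) * (PI / 2) ^ (2 * S k)
      * / INR (fact (2 * S k)) * zeta (INR (2 * S t + 1 - 2 * S k))));
      [unfold Rdiv; ring|].
    rewrite <- Rpow_mult_distr; replace (-1 * -1) with 1 by ring; rewrite pow1.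
    unfold Rdiv; ring. }
set (a := 2 ^ (2 * S t)).
assert (Ha : 1 <= a) by (apply pow_R1_Rle; lra).
replace (2 ^ (4 * S t + 1)) with (2 * (a * a))
  by (unfold a; rewrite <- pow_add, tech_pow_Rmult; f_equal; lia).
replace (2 ^ (2 * S t + 1)) with (2 * a) in *
  by (unfold a; rewrite tech_pow_Rmult; f_equal; lia).
replace (4 ^ (2 * S t + 1)) with (4 * (a * a)) in H.
2:{ unfold a; rewrite <- Rpow_mult_distr; replace (2 * 2) with 4 by ring.
    rewrite tech_pow_Rmult; f_equal; lia. }
replace ((PI / 2) ^ (2 * S t)) with (PI ^ (2 * S t) * / a) in H
  by (unfold a, Rdiv; rewrite Rpow_mult_distr, pow_inv; reflexivity).
assert (He : (-1) ^ t * (-1) ^ t = 1).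
{ rewrite <- Rpow_mult_distr; replace (-1 * -1) with 1 by ring; apply pow1. }
rewrite <- tech_pow_Rmult in H.
pose proof (INR_fact_neq_0 (2 * S t)) as Hf.
set (e := (-1) ^ t) in *; clearbody e a U.
set (Z := zeta (INR (2 * S t + 1))) in *; set (f := INR (fact (2 * S t))) in *.
set (h := harmonic (2 * S t) - ln (PI / 2)) in *; set (p := PI ^ (2 * S t)) in *.
set (T := Series (even_zeta_term (S t))) in *; clearbody Z f h p T.
assert (HD : 0 < 2 * (a * a) + a - 1) by nra.
(* With [a = 2 ^ (2 r)], multiplying the relation by [e * 2 a ^ 2] turns the factor
   [1 - 2 / (4 a ^ 2) + 1 / (2 a)] of [Z] into the denominator of the formula, since [e ^ 2 = 1]. *)
assert (Hz : Z * (2 * (a * a) + a - 1)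
  = 2 * (a * a) * U + e * (2 * (a * a)) * (p * / a * (/ f * h + T))).
{ rewrite <- H.
  transitivity (2 * (a * a) * U + e * e * (2 * (a * a)) *
    (Z - U - (2 / (4 * (a * a)) - / (2 * a)) * Z)); [|ring].
  rewrite He; field; lra. }
apply Rmult_eq_reg_r with (2 * (a * a) + a - 1); [|lra].
rewrite Hz; field; repeat split; lra.
Qed.

(** Euler's formula makes the two series proportional; the factor 2 is the difference between
    [2 ^ (2 r)] and [2 ^ (2 r + 1)] in front of them. *)
Lemma Bstar_term (r n : nat) :
  1 / INR (S n) * (Bstar (S n) / INR (fact (2 * r + 2 * S n))) * (PI / 2) ^ (2 * S n)
  = 2 * even_zeta_term r n.
Proof.
unfold even_zeta_term; rewrite Bstar_zeta.
replace (2 * PI) with (4 * (PI / 2)) by field; rewrite Rpow_mult_distr.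
pose proof PI_RGT_0 as HP; pose proof (INR_S_pos n).
set (c := INR (S n)) in *; clearbody c.
generalize (zeta (INR (2 * S n))); intros z.
field; repeat split; try apply pow_nonzero; try apply INR_fact_neq_0; lra.
Qed.

Theorem theorem15 (r : nat) (hr : (1 <= r)%nat) :
  (forall s : nat, (1 <= s)%nat ->
     sum_n_m (fun k => (-1) ^ k * Binomial.C (2 * s + 1) (2 * k + 1) * Bstar (k + 1))
       0 (s - 1) = 1 / 2)
  /\
  (ex_series (fun n => let k := S n in
     1 / INR k * (Bstar k / INR (fact (2 * r + 2 * k))) * (PI / 2) ^ (2 * k))
   /\
   zeta (INR (2 * r + 1)) =
     2 ^ (4 * r + 1) / (2 ^ (4 * r + 1) + 2 ^ (2 * r) - 1)
       * sum_n_m (fun k =>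
           (-1) ^ (k - 1) * (1 / INR (fact (2 * k))) * (PI / 2) ^ (2 * k)
             * zeta (INR (2 * r + 1 - 2 * k))) 1 (r - 1)
     + (-1) ^ (r - 1)
       * (2 ^ (2 * r + 1) * PI ^ (2 * r)
          / ((2 ^ (4 * r + 1) + 2 ^ (2 * r) - 1) * INR (fact (2 * r))))
       * (harmonic (2 * r) - ln (PI / 2))
     + (-1) ^ (r - 1)
       * (2 ^ (2 * r) * PI ^ (2 * r) / (2 ^ (4 * r + 1) + 2 ^ (2 * r) - 1))
       * Series (fun n => let k := S n in
           1 / INR k * (Bstar k / INR (fact (2 * r + 2 * k))) * (PI / 2) ^ (2 * k)))
  /\
  (ex_series (fun n => let k := S n in
     INR (fact (2 * k)) / (4 ^ (2 * k) * INR (fact (2 * r + 2 * k)) * INR k)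
       * zeta (INR (2 * k)))
   /\
   zeta (INR (2 * r + 1)) =
     2 ^ (4 * r + 1) / (2 ^ (4 * r + 1) + 2 ^ (2 * r) - 1)
       * sum_n_m (fun k =>
           (-1) ^ (k - 1) * (1 / INR (fact (2 * k))) * (PI / 2) ^ (2 * k)
             * zeta (INR (2 * r + 1 - 2 * k))) 1 (r - 1)
     + (-1) ^ (r - 1)
       * (2 ^ (2 * r + 1) * PI ^ (2 * r)
          / ((2 ^ (4 * r + 1) + 2 ^ (2 * r) - 1) * INR (fact (2 * r))))
       * (harmonic (2 * r) - ln (PI / 2))
     + (-1) ^ (r - 1)
       * (2 ^ (2 * r + 1) * PI ^ (2 * r) / (2 ^ (4 * r + 1) + 2 ^ (2 * r) - 1))
       * Series (fun n => let k := S n in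
           INR (fact (2 * k)) / (4 ^ (2 * k) * INR (fact (2 * r + 2 * k)) * INR k)
             * zeta (INR (2 * k)))).
Proof.
split; [exact Bstar_recurrence|split; split].
- apply ex_series_ext with (fun n => 2 * even_zeta_term r n).
  + intros n; symmetry; apply Bstar_term.
  + apply (ex_series_scal_l (V := R_NormedModule)), ex_series_even_zeta_term.
- cbv zeta; rewrite (Series_ext _ _ (Bstar_term r)), Series_scal_l.
  rewrite (zeta_odd_formula r hr) at 1; f_equal.
  rewrite (pow_add 2 (2 * r) 1), pow_1; unfold Rdiv; ring.
- apply ex_series_even_zeta_term.
- exact (zeta_odd_formula r hr).
Qed.
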